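(* Let $S$ be a compact, connected, non-positively curved special cube complex, $\Gamma$ its fundamental group, $X$ its universal covering, and $\ell:\vec{\mathcal E}(X)\to\Sigma_0$ a surjective $\Gamma$-invariant admissible edge labeling on $X$. Suppose that the action of $\Gamma$ on $X$ is vertex-transitive and suppose there exists some $s\in\Sigma_0$ such that for any two distinct $t,r\in\Sigma_0$ with $[s,t]=[s,r]=1$, we have either $t=r^{-1}$ or $[t,r]=1$. Then $\mathrm{Aut}^+(X)$ is locally compact.
   Context: $\mathrm{Aut}(X)$ is the group of cubical automorphisms of $X$ with the compact-open topology. $\mathrm{Aut}^+(X)$ is the subgroup of $\mathrm{Aut}(X)$ generated by all elements that fix some halfspace of $X$ pointwise (no closure is taken), with the subspace topology. ''Special'' is in the sense of Haglund--Wise (hyperplanes are embedded and two-sided, do not directly self-osculate, and do not inter-osculate). $\vec{\mathcal E}(X)$ is the set of oriented edges, $\vec{\mathcal E}(X)_v$ those starting at $v$. Oriented edges are parallel if they cross the same hyperplane in the same direction. Two edges with exactly one common endpoint span a square if they are two sides of a common square. An admissible edge labeling is a map $\ell:\vec{\mathcal E}(X)\to\Sigma_0$ to a finite set $\Sigma_0$ with fixpoint-free involution $s\mapsto s^{-1}$ such that: (A1) parallel oriented edges have equal labels and reversing orientation inverts the label; (A2) $\ell|_{\vec{\mathcal E}(X)_v}$ is injective for each vertex $v$; (A3) if $e_1,e_2\in\vec{\mathcal E}(X)_v$, $e_1',e_2'\in\vec{\mathcal E}(X)_w$ with $\ell(e_i)=\ell(e_i')$ for $i=1,2$, then $e_1,e_2$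 span a square iff $e_1',e_2'$ do. It is $\Gamma$-invariant if $\ell(g(e))=\ell(e)$ for all $g\in\Gamma$ and all $e$. Labels $s,t\in\Sigma_0$ commute, written $[s,t]=1$, if at some vertex there are outgoing edges labeled $s$ and $t$ that span a square. *)

(* Defs.v *)
From HB Require Import structures.
From mathcomp Require Import all_boot all_order all_algebra.
From mathcomp Require Import all_classical all_reals all_analysis.
From mathcomp Require Import homotopy.
From Stdlib Require Import Relation_Operators.

Set Implicit Arguments.
Unset Strict Implicit.
Unset Printing Implicit Defensive.

Import Order.TTheory GRing.Theory Num.Theory.
Import numFieldNormedType.Exports.
Local Open Scope classical_set_scope.
Local Open Scope ring_scope.
Local Open Scope quotient_scope.

(* An isometric embedding of [0,1]^m onto a face of [0,1]^n sends (x_j) to the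
   point whose i-th coordinate is a constant e in {0,1} (encoded [inl e]), or
   x_j ([inr (j, false)]), or 1 - x_j ([inr (j, true)]), each j < m being used
   for exactly one i. *)

Definition uses m (j : 'I_m) (u : bool + 'I_m * bool) : bool :=
  if u is inr (k, _) then k == j else false.

Definition cmap_ok m n (a : {ffun 'I_n -> bool + 'I_m * bool}) : bool :=
  [forall j, #|[pred i | uses j (a i)]| == 1%N].

Record cmap (m n : nat) := CMap {
  cmap_fun :> {ffun 'I_n -> bool + 'I_m * bool};
  cmap_prop : cmap_ok cmap_fun }.

Fact cmap_id_ok n : cmap_ok [ffun i : 'I_n => inr (i, false)].
Proof.
apply/forallP => j; rewrite (@eq_card _ _ (pred1 j)) ?card1// => i.
by rewrite !inE ffunE.
Qed.
Definition cmap_id n : cmap n n := CMap (cmap_id_ok n).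

Definition cmap_comp_fun k m n (a : cmap m n) (b : cmap k m) :=
  [ffun i => match a i with
             | inl e => inl e
             | inr (j, s) => match b j with
                             | inl e => inl (e (+) s)
                             | inr (l, t) => inr (l, t (+) s)
                             end
             end].

Fact cmap_comp_ok k m n (a : cmap m n) (b : cmap k m) :
  cmap_ok (cmap_comp_fun a b).
Proof.
apply/forallP => l.
have /forallP/(_ l)/eqP/mem_card1[j bj] := cmap_prop b.
have /forallP/(_ j)/eqP/mem_card1[i ai] := cmap_prop a.
rewrite (@eq_card _ _ (pred1 i)) ?card1// => i'; rewrite -ai !inE ffunE.
case: (a i') => [//|[j' s]] /=.
have := bj j'; rewrite !inE => <-.
by case: (b j') => [//|[]].
Qed.
Definition cmap_comp k m n (a : cmap m n) (b : cmap k m) : cmap k n :=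
  CMap (cmap_comp_ok a b).

Fact cmap_vtx_ok n (w : 'I_n -> bool) :
  cmap_ok [ffun i => inl (w i) : bool + 'I_0 * bool].
Proof. by apply/forallP => -[]. Qed.
(* The vertex w of [0,1]^n. *)
Definition cmap_vtx n (w : 'I_n -> bool) : cmap 0 n := CMap (cmap_vtx_ok w).

Fact cmap_edge_ok n (w : 'I_n -> bool) (i : 'I_n) :
  cmap_ok [ffun k => if k == i then inr (ord0 : 'I_1, false) else inl (w k)].
Proof.
apply/forallP => j; rewrite (@eq_card _ _ (pred1 i)) ?card1// => k.
by rewrite !inE ffunE; case: (k == i) => //=; rewrite (ord1 j).
Qed.
(* The edge of [0,1]^n in direction i, oriented increasingly, whose other
   coordinates are those of w ([w i] is irrelevant). *)
Definition cmap_edge n (w : 'I_n -> bool) (i : 'I_n) : cmap 1 n :=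
  CMap (cmap_edge_ok w i).

Fact cmap_rev_ok : cmap_ok [ffun _ : 'I_1 => inr (ord0 : 'I_1, true)].
Proof.
apply/forallP => j; rewrite (@eq_card _ _ predT) ?card_ord// => k.
by rewrite !inE ffunE /= (ord1 j).
Qed.
Definition cmap_rev : cmap 1 1 := CMap cmap_rev_ok.

(* [K n] is the set of parametrized n-cubes: a geometric n-cube together with
   one of its 2^n n! isometric identifications with [0,1]^n. Thus [K 0] is the
   set of vertices and [K 1] the set of oriented edges. [face a c] is c
   restricted along a; [face_free] says that no cube is folded or glued to
   itself along its interior. Cubes need not be embedded. *)
Record cube_complex := CubeComplex {
  cell :> nat -> choiceType;
  face : forall m n, cmap m n -> cell n -> cell m;
  face_id : forall n (c : cell n), face (cmap_id n) c = c;
  face_comp : forall k m n (a : cmap m n) (b : cmap k m) (c : cell n),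
    face (cmap_comp a b) c = face b (face a c);
  face_free : forall n (a : cmap n n) (c : cell n),
    face a c = c -> a = cmap_id n }.

Record cube_hom (K L : cube_complex) := Hom {
  hom_fun :> forall n, K n -> L n;
  hom_face : forall m n (a : cmap m n) (c : K n),
    hom_fun (face a c) = face a (hom_fun c) }.

Definition is_auto (K : cube_complex) (g : cube_hom K K) : Prop :=
  forall n, bijective (@hom_fun _ _ g n).

Section UnitInterval.
Variable R : realType.

Definition uinterval : Type := set_type [set x : R | 0 <= x <= 1].
HB.instance Definition _ := Topological.copy uinterval
  (set_type [set x : R | 0 <= x <= 1]).

Fact ui_bool_subproof (e : bool) : (e%:R : R) \in [set x : R | 0 <= x <= 1].
Proof. by apply: mem_set; case: e; rewrite /= ?lexx ?ler01. Qed.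
Definition ui_bool (e : bool) : uinterval :=
  exist _ (e%:R : R) (ui_bool_subproof e).

Fact ui_opp_subproof (x : uinterval) :
  1 - set_val x \in [set x : R | 0 <= x <= 1].
Proof.
apply: mem_set; have := set_valP x => /= /andP[x0 x1].
by rewrite subr_ge0 x1 lerBlDr lerDl.
Qed.
Definition ui_opp (x : uinterval) : uinterval :=
  exist _ (1 - set_val x) (ui_opp_subproof x).

Fact ui_neq : ui_bool false != ui_bool true.
Proof. by apply/eqP => -[] /eqP; rewrite eq_sym oner_eq0. Qed.
HB.instance Definition _ := isBiPointed.Build uinterval ui_neq.

End UnitInterval.

Definition cube (R : realType) (n : nat) : Type :=
  {ptws 'I_n -> uinterval R}.
HB.instance Definition _ R n := Topological.on (cube R n).

Definition cmap_act (R : realType) m n (a : cmap m n) (x : cube R m) :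
    cube R n :=
  fun i => match a i with
           | inl e => ui_bool R e
           | inr (j, s) => if s then ui_opp (x j) else x j
           end.

Section Realization.
Variables (R : realType) (K : cube_complex).

(* The disjoint union of one copy of [0,1]^n for each parametrized n-cube. *)
Definition precomplex : Type :=
  {c : {n : nat & K n} & cube R (projT1 c)}.
HB.instance Definition _ := Topological.on precomplex.

Definition prept n (c : K n) (x : cube R n) : precomplex :=
  existT (fun c : {n : nat & K n} => cube R (projT1 c)) (existT _ n c) x.

Variant glue_step : precomplex -> precomplex -> Prop :=
  GlueStep m n (a : cmap m n) (c : K n) (x : cube R m) :
    glue_step (prept (face a c) x) (prept c (cmap_act a x)).

Definition glue : rel precomplex :=
  fun y z => `[< clos_refl_sym_trans _ glue_step y z >].

Fact glue_refl : reflexive glue.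
Proof. by move=> y; apply/asboolP; exact: rst_refl. Qed.
Fact glue_sym : symmetric glue.
Proof. by move=> y z; apply/asboolP/asboolP; exact: rst_sym. Qed.
Fact glue_trans : transitive glue.
Proof.
by move=> z y t /asboolP yz /asboolP zt; apply/asboolP; exact: rst_trans yz zt.
Qed.
Definition glue_equiv := EquivRel glue glue_refl glue_sym glue_trans.

Definition geo := {eq_quot glue_equiv}.
HB.instance Definition _ := Topological.copy geo (quotient_topology geo).
HB.instance Definition _ := Quotient.on geo.

Definition geo_pt n (c : K n) (x : cube R n) : geo := \pi_geo (prept c x).

End Realization.

Definition geo_map (R : realType) (K L : cube_complex) (f : cube_hom K L)
    (z : geo R K) : geo R L :=
  let y := repr z in geo_pt (f _ (projT2 (projT1 y))) (projT2 y).

Lemma geo_mapE (R : realType) (K L : cube_complex) (f : cube_hom K L)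
    n (c : K n) (x : cube R n) : geo_map f (geo_pt c x) = geo_pt (f n c) x.
Proof.
pose F (y : precomplex R K) := geo_pt (f _ (projT2 (projT1 y))) (projT2 y).
rewrite -[RHS]/(F (prept c x)) /geo_map -/(F _).
have : prept c x = repr (geo_pt c x) %[mod geo R K] by rewrite reprK.
move=> /eqmodP/asboolP; elim=> [y z []|y|y z _ <-|y z t _ -> _ ->]//.
move=> m k a d u; rewrite /F /=.
by apply/eqmodP/asboolP/rst_sym; rewrite hom_face; apply/rst_step.
Qed.

Section Combinatorics.
Variable K : cube_complex.

Definition src (e : K 1%N) : K 0%N := face (cmap_vtx (fun=> false)) e.
Definition tgt (e : K 1%N) : K 0%N := face (cmap_vtx (fun=> true)) e.
Definition rev_edge (e : K 1%N) : K 1%N := face cmap_rev e.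

Definition cell_vtx n (c : K n) : K 0%N := face (cmap_vtx (fun=> false)) c.
(* The edge of c issuing from the vertex [cell_vtx c] in direction i. *)
Definition cell_edge n (c : K n) (i : 'I_n) : K 1%N :=
  face (cmap_edge (fun=> false) i) c.

Definition opposite (e f : K 1%N) : Prop := exists q : K 2%N,
  e = face (cmap_edge (fun=> false) ord0) q /\
  f = face (cmap_edge (fun=> true) ord0) q.

(* Crossing the same hyperplane in the same direction. *)
Definition parallel : K 1%N -> K 1%N -> Prop :=
  clos_refl_sym_trans _ opposite.

Definition same_hyperplane (e f : K 1%N) : Prop :=
  parallel e f \/ parallel e (rev_edge f).

(* The oriented edges e and f form the corner of a square at their common
   origin, i.e. they are adjacent in its link. *)
Definition corner (e f : K 1%N) : Prop :=
  exists q : K 2%N, cell_edge q ord0 = e /\ cell_edge q ord_max = f.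

Definition endpoints (e : K 1%N) : set (K 0%N) := [set src e; tgt e].

Definition span_square (e f : K 1%N) : Prop :=
  (exists v, endpoints e `&` endpoints f = [set v]) /\
  exists (q : K 2%N) (a b : cmap 1 2), face a q = e /\ face b q = f.

(* Gromov's condition: the link of every vertex is a flag simplicial complex.
   The vertices of the link of v are the oriented edges issuing from v, and an
   n-cube c with [cell_vtx c = v] spans the simplex with vertices
   [cell_edge c i], i < n. *)
Record nonpositively_curved : Prop := NPC {
  link_no_loop : forall q : K 2%N, cell_edge q ord0 <> cell_edge q ord_max;
  link_simplicial : forall n (c d : K n), cell_vtx c = cell_vtx d ->
    (forall i, cell_edge c i = cell_edge d i) -> c = d;
  link_flag : forall (v : K 0%N) n (e : 'I_n -> K 1%N),
    (forall i, src (e i) = v) ->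
    (forall i j, i != j -> corner (e i) (e j)) ->
    exists c : K n, cell_vtx c = v /\ forall i, cell_edge c i = e i }.

Definition hyperplanes_cross (e f : K 1%N) : Prop := exists e' f',
  [/\ same_hyperplane e e', same_hyperplane f f' & corner e' f'].

Definition hyperplanes_osculate (e f : K 1%N) : Prop := exists e' f',
  [/\ same_hyperplane e e', same_hyperplane f f', src e' = src f',
      e' <> f' & ~ corner e' f'].

(* Special in the sense of Haglund and Wise; a hyperplane is represented by
   any oriented edge dual to it. *)
Record special : Prop := Special {
  hyp_embedded : forall e : K 1%N, ~ hyperplanes_cross e e;
  hyp_two_sided : forall e : K 1%N, ~ parallel e (rev_edge e);
  no_direct_self_osculation : forall e f : K 1%N,
    parallel e f -> src e = src f -> e <> f -> corner e f;
  no_inter_osculation : forall e f : K 1%N, ~ same_hyperplane e f ->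
    ~ (hyperplanes_cross e f /\ hyperplanes_osculate e f) }.

Record admissible (Sigma0 : finType) (inv : Sigma0 -> Sigma0)
    (l : K 1%N -> Sigma0) : Prop := Admissible {
  label_parallel : forall e f, parallel e f -> l e = l f;
  label_rev : forall e, l (rev_edge e) = inv (l e);
  label_inj : forall e f, src e = src f -> l e = l f -> e = f;
  label_square : forall e1 e2 f1 f2, src e1 = src e2 -> src f1 = src f2 ->
    l e1 = l f1 -> l e2 = l f2 -> (span_square e1 e2 <-> span_square f1 f2) }.

Definition labels_commute (Sigma0 : finType) (l : K 1%N -> Sigma0)
    (s t : Sigma0) : Prop := exists e f,
  [/\ src e = src f, l e = s, l f = t & span_square e f].

End Combinatorics.

Definition covering_map (T U : topologicalType) (q : T -> U) : Prop :=
  [/\ continuous q, range q = [set: U] &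
  forall u, exists2 V : set U, open_nbhs u V &
    exists (I : Type) (W : I -> set T),
    [/\ forall i, open (W i), trivIset setT W, q @^-1` V = \bigcup_i W i &
        forall i, [/\ set_bij (W i) V q &
                      forall A, A `<=` W i -> open A -> open (q @` A)]]].

(* H is a homotopy relative to the endpoints from the loop g to the constant
   loop; the first coordinate is the homotopy parameter. *)
Definition simply_connected (R : realType) (T : topologicalType) : Prop :=
  (forall x y : T, exists g : {path uinterval R from x to y}, True) /\
  (forall (x : T) (g : {path uinterval R from x to x}),
     exists H : uinterval R * uinterval R -> T,
     [/\ continuous H, forall t, H (zero, t) = g t, forall t, H (one, t) = x &
         forall s, H (s, zero) = x /\ H (s, one) = x]).

Definition universal_covering (R : realType) (X S : cube_complex)
    (p : cube_hom X S) : Prop :=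
  covering_map (geo_map p : geo R X -> geo R S) /\ simply_connected R (geo R X).

(* The fundamental group of S acting on X by deck transformations. *)
Definition deck (X S : cube_complex) (p : cube_hom X S) (g : cube_hom X X) :
    Prop :=
  is_auto g /\ forall n (c : X n), p n (g n c) = p n c.

Section Automorphisms.
Variables (R : realType) (X : cube_complex).

(* The union of the midcubes dual to the edges parallel to e. *)
Definition hyperplane (e : X 1%N) : set (geo R X) :=
  [set z | exists n (c : X n) (x : cube R n) (i : 'I_n),
     [/\ z = geo_pt c x, set_val (x i) = 2^-1 &
         same_hyperplane e (cell_edge c i)]].

Definition halfspace (h : set (geo R X)) : Prop :=
  exists e x, (~` hyperplane e) x /\
    h = connected_component (~` hyperplane e) x.

Definition cube_Aut : set {compact-open, geo R X -> geo R X} :=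
  [set geo_map g | g in @is_auto X].

Definition subgroup (H : set {compact-open, geo R X -> geo R X}) : Prop :=
  [/\ H idfun, forall f g, H f -> H g -> H (f \o g) &
      forall f g, H f -> cancel f g -> cancel g f -> H g].

Definition fixes_halfspace (f : geo R X -> geo R X) : Prop :=
  exists2 h, halfspace h & forall x, h x -> f x = x.

(* A subset of a function space: [set_type (cube_Aut_plus R X)] is the group
   with its subspace topology, whereas [locally_compact (cube_Aut_plus R X)]
   would only ask for compact neighborhoods in the ambient space. *)
Definition cube_Aut_plus : set {compact-open, geo R X -> geo R X} :=
  smallest subgroup (cube_Aut `&` fixes_halfspace).

End Automorphisms.

Arguments cube_Aut : clear implicits.
Arguments cube_Aut_plus : clear implicits.

(* Main.v *)
Require Import Defs.
From HB Require Import structures.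
From mathcomp Require Import all_boot all_order all_algebra.
From mathcomp Require Import all_classical all_reals all_analysis.
From mathcomp Require Import lra homotopy.
From Stdlib Require Import Relation_Operators.

(** Since X is locally finite, it suffices to show that Aut+(X) contains every
automorphism g fixing a vertex v together with all edges at v: the elements of
Aut+(X) that agree with a given one on the edges at v then form a clopen set,
which is compact by an ultrafilter argument (the limit of the combinatorial
automorphisms exists cell by cell, and again lies in Aut+(X)).

Let e be the edge at v labelled by s. By the assumption on s, the edges
cornering with an edge parallel to e look like a product of lines, so that g,
being the identity near v, is the identity on the whole carrier of the
hyperplane h dual to e. As h separates X, g is the product of two automorphisms,
each equal to g on one side of h and to the identity on the other.

That h separates follows from simple connectivity: a closed edge path crosses h
an even number of times, because the double covering of X whose sheets are
exchanged by crossing h is trivial over the square parametrizing a contraction of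
the path. *)

Set Implicit Arguments.
Unset Strict Implicit.
Unset Printing Implicit Defensive.

Import Order.TTheory GRing.Theory Num.Theory.
Import numFieldNormedType.Exports.
Local Open Scope classical_set_scope.
Local Open Scope ring_scope.
Local Open Scope quotient_scope.

(** * Faces of cubes *)

(** No closure is taken in the definition of Aut+(X), so a limit of its elements need not lie in it
    for free. Here it does, because the limit agrees with a fixed element on all edges at one
    vertex: the two differ by an automorphism fixing that star, which is a product of two
    generators. Labels serve as finite local coordinates. Transitivity of the label-preserving deck
    group puts every label at every vertex, exactly once, so an edge is known from its source and
    its label, and an edge labelled s is available wherever needed. Topology and combinatorics meet
    in predicates on pairs of a cube and a point that are compatible with faces; these describe the
    sets of the realization that occur. The action on oriented edges is read off at the points one
    third along the edges. Parity is obtained without making a contraction cellular: the complement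
    of the hyperplane and its open carrier are two open sets trivializing the double covering, and
    only their preimages in the square are used. *)

Lemma cmapP m n (a b : cmap m n) : (forall i, a i = b i) -> a = b.
Proof.
case: a b => [a pa] [b pb] /= /ffunP E; case: _ / E in pb *.
by rewrite (bool_irrelevance pa pb).
Qed.

Lemma cmap_ok_pos m n (a : {ffun 'I_n -> bool + 'I_m * bool}) (g : 'I_m -> 'I_n) :
  (forall i j, uses j (a i) = (i == g j)) -> cmap_ok a.
Proof.
move=> H; apply/forallP => j; rewrite (@eq_card _ _ (pred1 (g j))) ?card1// => i.
by rewrite !inE H.
Qed.

Lemma cmap_pos m n (a : cmap m n) :
  exists g : 'I_m -> 'I_n, forall i j, uses j (a i) = (i == g j).
Proof.
suff /choice[g Hg] : forall j, exists k, forall i, uses j (a i) = (i == k).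
  by exists g => i j; exact: Hg.
move=> j; have /forallP/(_ j)/eqP/mem_card1[k ak] := cmap_prop a.
by exists k => i; have := ak i; rewrite !inE.
Qed.

(** The face [a] lies in the face [b], since it keeps the constant coordinates of [b]. The factor is
    read off at the position [gb j] carrying the j-th coordinate of [b], after undoing the
    reflection [sg j]. *)
Lemma cmap_factor k m n (b : cmap k n) (a : cmap m n) :
  (forall i e, b i = inl e -> a i = inl e) -> exists a', a = cmap_comp b a'.
Proof.
move=> H; have [gb Hb] := cmap_pos b; have [ga Ha] := cmap_pos a.
have /choice[sg Hs] : forall j, exists s, b (gb j) = inr (j, s).
  move=> j; have := Hb (gb j) j; rewrite eqxx.
  by case: (b (gb j)) => [//|[l s]] /eqP /= ->; exists s.
pose f := [ffun j => match a (gb j) with inl e => inl (e (+) sg j)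
                     | inr (l, t) => inr (l, t (+) sg j) end : bool + 'I_m * bool].
have /choice[h Hh] : forall l, exists j, ga l = gb j.
  move=> l; case E : (b (ga l)) => [e|[j s]].
    by have := Ha (ga l) l; rewrite (H _ _ E) eqxx.
  by exists j; apply/eqP; rewrite -Hb E /= eqxx.
have okf : cmap_ok f.
  apply: (@cmap_ok_pos _ _ _ h) => j l; rewrite ffunE.
  transitivity (uses l (a (gb j))); first by case: (a (gb j)) => [//|[]].
  rewrite Ha Hh; apply/eqP/eqP => [E|->//].
  by have := Hs j; rewrite E Hs => -[].
exists (CMap okf); apply: cmapP => i; rewrite ffunE.
case E : (b i) => [e|[j s]]; first by rewrite (H _ _ E).
have Ei : i = gb j by apply/eqP; rewrite -Hb E /=.
have Es : s = sg j by have := Hs j; rewrite -Ei E => -[].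
rewrite /= ffunE -Ei Es.
by case: (a i) => [e|[l t]]; rewrite -addbA addbb addbF.
Qed.

Fact cmap_refl_ok n (w : 'I_n -> bool) : cmap_ok [ffun i => inr (i, w i)].
Proof. by apply: (@cmap_ok_pos _ _ _ id) => i j; rewrite ffunE. Qed.
(** This reflection carries the origin to the vertex [w], so that facts about [cell_vtx] and
    [cell_edge] become available at every vertex of a cube. *)
Definition cmap_refl n (w : 'I_n -> bool) : cmap n n := CMap (cmap_refl_ok w).

Fact cmap_sq_ok n (w : 'I_n -> bool) (i k : 'I_n) : i != k ->
  cmap_ok [ffun j => if j == i then inr (ord0 : 'I_2, false)
                     else if j == k then inr (ord_max : 'I_2, false)
                     else inl (w j)].
Proof.
move=> ik; apply: (@cmap_ok_pos _ _ _ (fun j : 'I_2 => if j == ord0 then i else k)).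
move=> j l; rewrite ffunE; have ki := negbTE ik; have ki' := ki; rewrite eq_sym in ki'.
case: (eqVneq j i) => [->|/negbTE ji] /=.
  by case: l => -[|[|[]]]//= ?; rewrite ?eqxx.
case: (eqVneq j k) => [->|/negbTE jk] /=; case: l => -[|[|[]]]//= ?;
  by rewrite ?eqxx ?ki' ?ji ?jk.
Qed.
Definition cmap_sq n (w : 'I_n -> bool) (i k : 'I_n) (ik : i != k) : cmap 2 n :=
  CMap (cmap_sq_ok w ik).

Definition upd n (w : 'I_n -> bool) k b : 'I_n -> bool :=
  fun j => if j == k then b else w j.

Lemma cmap0P n (a : cmap 0 n) : exists w, a = cmap_vtx w.
Proof.
exists (fun i => if a i is inl e then e else false); apply: cmapP => i.
by rewrite ffunE; case: (a i) => [//|[[]]].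
Qed.

Lemma cmap1P n (a : cmap 1 n) : exists w i b,
  a = cmap_comp (cmap_edge w i) (cmap_refl (fun=> b)).
Proof.
have [g Hg] := cmap_pos a; have := Hg (g ord0) ord0; rewrite eqxx.
case E : (a (g ord0)) => [//|[j s]] _; rewrite (ord1 j) {j} in E.
exists (fun i => if a i is inl e then e else false), (g ord0), s.
apply: cmapP => i; rewrite !ffunE; case: (eqVneq i (g ord0)) => [->|].
  by rewrite E ffunE /= addbF.
rewrite -Hg; case: (a i) => [//|[j t]].
by rewrite (ord1 j).
Qed.

Lemma cmap_rev_refl : cmap_rev = cmap_refl (fun=> true).
Proof. by apply: cmapP => i; rewrite !ffunE (ord1 i). Qed.

Lemma cmap_refl_id n : cmap_refl (fun _ : 'I_n => false) = cmap_id n.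
Proof. by apply: cmapP => i; rewrite !ffunE. Qed.

Lemma cmap_vtx_ext n (w w' : 'I_n -> bool) : w =1 w' -> cmap_vtx w = cmap_vtx w'.
Proof. by move=> E; apply: cmapP => i; rewrite !ffunE E. Qed.

Lemma cmap_edge_ext n (w w' : 'I_n -> bool) i :
  (forall j, j != i -> w j = w' j) -> cmap_edge w i = cmap_edge w' i.
Proof. by move=> E; apply: cmapP => j; rewrite !ffunE; case: eqVneq => // /E ->. Qed.

Section Cells.
Variable K : cube_complex.
Implicit Types (e f : K 1%N) (q : K 2%N).

Lemma face_refl2 n (c : K n) w : face (cmap_refl w) (face (cmap_refl w) c) = c.
Proof.
rewrite -face_comp -[RHS](face_id c); congr face; apply: cmapP => i.
by rewrite !ffunE addbb.
Qed.

Lemma rev_edgeK e : rev_edge (rev_edge e) = e.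
Proof. by rewrite /rev_edge cmap_rev_refl face_refl2. Qed.

Lemma src_rev e : src (rev_edge e) = tgt e.
Proof.
rewrite /src /tgt /rev_edge -face_comp; congr face.
by apply: cmapP => i; rewrite !ffunE.
Qed.

Lemma tgt_rev e : tgt (rev_edge e) = src e.
Proof. by rewrite -src_rev rev_edgeK. Qed.

Lemma cell_vtx_refl n (c : K n) w :
  cell_vtx (face (cmap_refl w) c) = face (cmap_vtx w) c.
Proof.
by rewrite /cell_vtx -face_comp; congr face; apply: cmapP => i; rewrite !ffunE.
Qed.

Lemma cell_edge_refl n (c : K n) w i : cell_edge (face (cmap_refl w) c) i =
  if w i then rev_edge (face (cmap_edge w i) c) else face (cmap_edge w i) c.
Proof.
rewrite /cell_edge /rev_edge -!face_comp; case: ifPn => wi; rewrite -?face_comp;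
  congr face; apply: cmapP => j; rewrite !ffunE; case: eqVneq => [->|] //=.
by rewrite wi ffunE.
by rewrite (negbTE wi).
Qed.

Lemma src_edge n (c : K n) w i :
  src (face (cmap_edge w i) c) = face (cmap_vtx (upd w i false)) c.
Proof.
rewrite /src -face_comp; congr face; apply: cmapP => j.
by rewrite !ffunE /upd; case: eqVneq => //=; rewrite ffunE.
Qed.

Lemma tgt_edge n (c : K n) w i :
  tgt (face (cmap_edge w i) c) = face (cmap_vtx (upd w i true)) c.
Proof.
rewrite /tgt -face_comp; congr face; apply: cmapP => j.
by rewrite !ffunE /upd; case: eqVneq => //=; rewrite ffunE.
Qed.

Lemma src_cell_edge n (c : K n) i : src (cell_edge c i) = cell_vtx c.
Proof.
by rewrite /cell_edge src_edge; congr face; apply: cmap_vtx_ext => j; rewrite /upd; case: ifP.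
Qed.

Lemma edge_sq0 n (c : K n) w i k (ik : i != k) b :
  face (cmap_edge (fun=> b) ord0) (face (cmap_sq w ik) c) =
  face (cmap_edge (upd w k b) i) c.
Proof.
rewrite -face_comp; congr face; apply: cmapP => j; rewrite !ffunE /upd.
by case: eqVneq => [|ji] /=; rewrite ?ffunE//=; case: eqVneq; rewrite ?ffunE//= addbF.
Qed.

Lemma edge_sq1 n (c : K n) w i k (ik : i != k) b :
  face (cmap_edge (fun=> b) ord_max) (face (cmap_sq w ik) c) =
  face (cmap_edge (upd w i b) k) c.
Proof.
rewrite -face_comp; congr face; apply: cmapP => j; rewrite !ffunE /upd.
case: (eqVneq j i) => [->|ji] /=.
  by rewrite ffunE /= (negbTE ik) addbF.
by case: eqVneq; rewrite ?ffunE.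
Qed.

Lemma corner_cell n (c : K n) i k : i != k -> corner (cell_edge c i) (cell_edge c k).
Proof.
move=> ik; exists (face (cmap_sq (fun=> false) ik) c).
rewrite /cell_edge edge_sq0 edge_sq1.
by split; congr face; apply: cmap_edge_ext => j _; rewrite /upd; case: ifP.
Qed.

Lemma parallel_sym e f : parallel e f -> parallel f e.
Proof. exact: rst_sym. Qed.

Lemma parallel_trans f e e' : parallel e f -> parallel f e' -> parallel e e'.
Proof. exact: rst_trans. Qed.

Lemma parallel_refl e : parallel e e.
Proof. exact: rst_refl. Qed.

Lemma parallel_edge_upd n (c : K n) w i k b : k != i ->
  parallel (face (cmap_edge (upd w k b) i) c) (face (cmap_edge w i) c).
Proof.
move=> ki; have ik : i != k by rewrite eq_sym.
have H : parallel (face (cmap_edge (upd w k false) i) c)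
                  (face (cmap_edge (upd w k true) i) c).
  by apply: rst_step; exists (face (cmap_sq w ik) c); rewrite !edge_sq0.
have E : cmap_edge w i = cmap_edge (upd w k (w k)) i.
  by apply: cmap_edge_ext => j _; rewrite /upd; case: eqP => [->|].
rewrite [X in parallel _ (face X _)]E; case: b; case: (w k) => //;
  by [exact: parallel_refl|exact: parallel_sym].
Qed.

(** The coordinates of [w'] are turned into those of [w] one at a time; each change either leaves
    the edge as it is or replaces it by the opposite side of a square. *)
Lemma parallel_edge n (c : K n) w w' i :
  parallel (face (cmap_edge w i) c) (face (cmap_edge w' i) c).
Proof.
pose v (m : nat) (j : 'I_n) := if (j < m)%N then w j else w' j.
suff H m : parallel (face (cmap_edge (v m) i) c) (face (cmap_edge w' i) c).
  have -> // : cmap_edge w i = cmap_edge (v n) i.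
  by apply: cmap_edge_ext => j _; rewrite /v ltn_ord.
elim: m => [|m IH]; first exact: parallel_refl.
case: (ltnP m n) => [mn|nm]; last first.
  have -> // : cmap_edge (v m.+1) i = cmap_edge (v m) i.
  apply: cmap_edge_ext => j _; rewrite /v.
  by rewrite !(leq_trans (ltn_ord j))// ltnW.
have E : v m.+1 =1 upd (v m) (Ordinal mn) (w (Ordinal mn)).
  move=> j; rewrite /v /upd -val_eqE /= ltnS leq_eqVlt; case: eqVneq => //= E.
  by congr w; apply: val_inj.
case: (eqVneq (Ordinal mn) i) => [mi|mi].
  have -> // : cmap_edge (v m.+1) i = cmap_edge (v m) i.
  by apply: cmap_edge_ext => j ji; rewrite E /upd mi (negbTE ji).
have -> : cmap_edge (v m.+1) i = cmap_edge (upd (v m) (Ordinal mn) (w (Ordinal mn))) i.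
  by apply: cmap_edge_ext => j _; exact: E.
exact: parallel_trans (parallel_edge_upd _ _ _ mi) IH.
Qed.

Lemma opposite_rev e f : opposite e f -> opposite (rev_edge e) (rev_edge f).
Proof.
move=> [q [-> ->]]; exists (face (cmap_refl (fun i => i == ord0)) q).
rewrite /rev_edge -!face_comp; split; congr face; apply: cmapP => i;
  by rewrite !ffunE; case: i => -[|[|[]]]//= ?; rewrite ?ffunE//= ffunE.
Qed.

Lemma parallel_rev e f : parallel e f -> parallel (rev_edge e) (rev_edge f).
Proof.
elim=> [x y /opposite_rev|x|x y _|x y z _ H1 _ H2]; first exact: rst_step.
- exact: rst_refl.
- exact: rst_sym.
- exact: rst_trans H1 H2.
Qed.

Lemma same_hyperplane_sym e f : same_hyperplane e f -> same_hyperplane f e.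
Proof.
move=> [H|/parallel_rev H]; first by left; exact: parallel_sym.
by right; apply: parallel_sym; rewrite rev_edgeK in H.
Qed.

Lemma same_hyperplane_trans f e e' :
  same_hyperplane e f -> same_hyperplane f e' -> same_hyperplane e e'.
Proof.
move=> [H|H] [H'|H'].
- by left; exact: parallel_trans H'.
- by right; exact: parallel_trans H'.
- by right; apply: parallel_trans H _; exact: parallel_rev.
- left; apply: parallel_trans H _; rewrite -[e']rev_edgeK; exact: parallel_rev.
Qed.

Lemma same_hyperplane_rev e : same_hyperplane e (rev_edge e).
Proof. by right; rewrite rev_edgeK; exact: parallel_refl. Qed.

Lemma same_hyperplane_refl e : same_hyperplane e e.
Proof. by left; exact: parallel_refl. Qed.

Lemma corner_src e f : corner e f -> src e = src f.
Proof. by move=> [q [<- <-]]; rewrite !src_cell_edge. Qed.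

Lemma cell_edge_true n (c : K n) i : parallel (cell_edge c i) (face (cmap_edge (fun=> true) i) c).
Proof. exact: parallel_edge. Qed.

End Cells.

Section Homs.
Variables (K L : cube_complex) (f : cube_hom K L).

Lemma hom_src e : f _ (src e) = src (f _ e). Proof. exact: hom_face. Qed.
Lemma hom_tgt e : f _ (tgt e) = tgt (f _ e). Proof. exact: hom_face. Qed.
Lemma hom_rev e : f _ (rev_edge e) = rev_edge (f _ e). Proof. exact: hom_face. Qed.
Lemma hom_cell_edge n (c : K n) i : f _ (cell_edge c i) = cell_edge (f _ c) i.
Proof. exact: hom_face. Qed.
Lemma hom_cell_vtx n (c : K n) : f _ (cell_vtx c) = cell_vtx (f _ c).
Proof. exact: hom_face. Qed.

Lemma hom_parallel e e' : parallel e e' -> parallel (f _ e) (f _ e').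
Proof.
elim=> [x y [q [-> ->]]|x|x y _|x y z _ H1 _ H2].
- by apply: rst_step; exists (f _ q); rewrite !hom_face.
- exact: rst_refl.
- exact: rst_sym.
- exact: rst_trans H1 H2.
Qed.

Lemma hom_hyperplane e e' : same_hyperplane e e' -> same_hyperplane (f _ e) (f _ e').
Proof. by move=> [|] /hom_parallel H; [left|right]; rewrite -?hom_rev. Qed.

Lemma hom_corner e e' : corner e e' -> corner (f _ e) (f _ e').
Proof. by move=> [q [<- <-]]; exists (f _ q); rewrite !hom_cell_edge. Qed.

End Homs.

(** * Subsets of the geometric realization *)

Section Geo.
Variable R : realType.
Notation I := (uinterval R).

Lemma ui_inj (x y : I) : set_val x = set_val y -> x = y.
Proof. exact: val_inj. Qed.

Lemma ui_ge0 (x : I) : 0 <= set_val x.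
Proof. by have := set_valP x => /= /andP[]. Qed.

Lemma ui_le1 (x : I) : set_val x <= 1.
Proof. by have := set_valP x => /= /andP[]. Qed.

Lemma ui_boolE e : set_val (ui_bool R e) = e%:R. Proof. by []. Qed.
Lemma ui_oppE (x : I) : set_val (ui_opp x) = 1 - set_val x. Proof. by []. Qed.

Lemma cube_ext n (x y : cube R n) : (forall i, x i = y i) -> x = y.
Proof. exact: functional_extensionality_dep. Qed.

Lemma cube_coord_continuous n (i : 'I_n) : continuous (fun x : cube R n => set_val (x i)).
Proof.
move=> x; apply: (@continuous_comp _ _ _ (fun x : cube R n => x i)).
  exact: (@proj_continuous _ (fun _ : 'I_n => I) i).
exact: initial_continuous.
Qed.

Lemma open_cube n (P : 'I_n -> R -> Prop) : (forall i, open (P i : set R)) ->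
  open [set x : cube R n | forall i, P i (set_val (x i))].
Proof.
move=> oP; rewrite openE => x /= Px; rewrite /interior /=.
suff H i : \forall y \near nbhs x, P i (set_val (y i)) by exact: filter_forall H.
exact: (cube_coord_continuous (i := i) (x := x) (open_nbhs_nbhs (conj (oP i) (Px i)))).
Qed.

Section Complex.
Variable K : cube_complex.
Notation X := (geo R K).

Lemma geo_ind (P : X -> Prop) : (forall n (c : K n) (x : cube R n), P (geo_pt c x)) ->
  forall z, P z.
Proof.
move=> H z; rewrite -[z]reprK; case: (repr z) => -[n c] x; exact: (H n c x).
Qed.

Lemma geo_glue m n (a : cmap m n) (c : K n) (x : cube R m) :
  geo_pt (face a c) x = geo_pt c (cmap_act a x).
Proof. by apply/eqmodP/asboolP/rst_step. Qed.

(** The predicates that descend to the realization: the gluing relation is generated by the passage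
    to a face, so invariance under that is enough. *)
Definition saturated (P : forall n, K n -> cube R n -> Prop) :=
  forall m n (a : cmap m n) (c : K n) (x : cube R m),
    P m (face a c) x <-> P n c (cmap_act a x).

Definition gset (P : forall n, K n -> cube R n -> Prop) : set X :=
  [set z | P _ (projT2 (projT1 (repr z))) (projT2 (repr z))].

Lemma gsetE P : saturated P -> forall n (c : K n) (x : cube R n),
  gset P (geo_pt c x) <-> P n c x.
Proof.
move=> sP n c x; pose F (y : precomplex R K) := P _ (projT2 (projT1 y)) (projT2 y).
rewrite -[P n c x]/(F (prept c x)) /gset /= -/(F _).
have : prept c x = repr (geo_pt c x) %[mod geo R K] by rewrite reprK.
move=> /eqmodP/asboolP; elim => [y z []|y|y z _ <-|y z t _ -> _ ->]//.
by move=> m k a d u; rewrite /F /=; split => /sP.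
Qed.

Lemma geo_open (U : set X) :
  (forall n (c : K n), open [set x : cube R n | U (geo_pt c x)]) -> open U.
Proof.
move=> oU; suff : open (\pi_X @^-1` U) by [].
by apply/sigT_openP => -[n c]; exact: (oU n c).
Qed.

Lemma gset_open P : saturated P ->
  (forall n (c : K n), open [set x : cube R n | P n c x]) -> open (gset P).
Proof.
move=> sP oP; apply: geo_open => n c.
have -> // : [set x | gset P (geo_pt c x)] = [set x | P n c x].
by apply/seteqP; split => x /=; rewrite gsetE.
Qed.

Lemma geo_pt_continuous n (c : K n) : continuous (fun x : cube R n => geo_pt c x).
Proof.
move=> x; apply: (@continuous_comp _ _ _ (fun x : cube R n => prept c x)).
  exact: (@existT_continuous _ (fun c : {n : nat & K n} => cube R (projT1 c)) (existT _ n c)).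
exact: pi_continuous.
Qed.

End Complex.
End Geo.

Lemma geo_map_comp (R : realType) (K L M : cube_complex) (g : cube_hom L M)
    (f : cube_hom K L) (h : cube_hom K M) :
  (forall n (c : K n), h n c = g n (f n c)) ->
  geo_map h = geo_map g \o (geo_map f : geo R K -> geo R L).
Proof.
move=> H; apply/funext => z; elim/geo_ind: z => n c x /=.
by rewrite !geo_mapE H.
Qed.

(** * Open stars and normal forms of points *)

Section Stars.
Variables (R : realType) (K : cube_complex).
Notation X := (geo R K).

(* Given the face d and prescribed sets of coordinates, the points that have
   these coordinates relative to d, seen from any cube containing d. *)
Definition star_cond m (E : bool -> set R) (V : 'I_m -> set R) n (a : cmap m n)
    (x : cube R n) := forall i, match a i with
  | inl e => E e (set_val (x i))
  | inr (j, s) => V j (if s then 1 - set_val (x i) else set_val (x i))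
  end.

Definition star m E V (d : K m) : set X :=
  gset (fun n c x => exists a, face a c = d /\ star_cond E V a x).

Variables (m : nat) (E : bool -> set R) (V : 'I_m -> set R).
Hypothesis E_end : forall e (e' : bool), E e e'%:R <-> e = e'.
Hypothesis E_opp : forall e r, E e (1 - r) <-> E (~~ e) r.
Hypothesis V_end : forall j (e : bool), ~ V j e%:R.

(** At a coordinate where the face [b] is constant, the point sits at an end, which satisfies [E]
    for that end alone and no [V j]. So [a] takes the same constant there and factors through
    [b]. *)
Lemma star_saturated (d : K m) :
  saturated (fun n c (x : cube R n) => exists a, face a c = d /\ star_cond E V a x).
Proof.
move=> k n b c x; split=> -[a [ad ax]].
  exists (cmap_comp b a); split; first by rewrite face_comp.
  move=> i; rewrite ffunE /cmap_act; case: (b i) => [e|[j s]]; first exact/E_end.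
  have := ax j; case: (a j) => [e|[l t]].
    by case: s; rewrite /= ?addbT ?addbF// => H; apply/E_opp; rewrite negbK.
  by case: s; case: t => //=; rewrite ?subKr.
have [i e bi|a' aE] := @cmap_factor _ _ _ b a.
  have := ax i; rewrite /cmap_act bi; case: (a i) => [e'|[l t]].
    by rewrite ui_boolE => /E_end ->.
  rewrite ui_boolE => H; exfalso; case: t H => [|/V_end//].
  have -> : 1 - e%:R = (~~ e)%:R :> R by case: e {bi}; rewrite ?subrr ?subr0.
  by move/V_end.
exists a'; split; first by rewrite -face_comp -aE.
move=> j; have [g Hg] := cmap_pos b; have := Hg (g j) j; rewrite eqxx.
case bE : (b (g j)) => [//|[l s]] /= /eqP lj; rewrite {l}lj in bE.
have := ax (g j); rewrite aE ffunE /cmap_act bE; case: (a' j) => [e|[l t]].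
  by case: s {bE} => /=; rewrite ?addbT ?addbF// => /E_opp; rewrite negbK.
by case: s {bE} => /=; case: t => //=; rewrite subKr.
Qed.

Lemma starE (d : K m) n (c : K n) (x : cube R n) :
  star E V d (geo_pt c x) <-> exists a, face a c = d /\ star_cond E V a x.
Proof. exact: (gsetE (@star_saturated d)). Qed.

Hypothesis E_open : forall e, open (E e).
Hypothesis V_open : forall j, open (V j).

Lemma star_open (d : K m) : open (star E V d).
Proof.
apply: gset_open; first exact: star_saturated.
move=> n c; have -> : [set x : cube R n | exists a, face a c = d /\ star_cond E V a x] =
    \bigcup_(a in [set a | face a c = d]) [set x : cube R n | star_cond E V a x].
  by apply/seteqP; split => x /= [a]; [case; exists a|exists a].
apply: bigcup_open => a _.
apply: (@open_cube _ _ (fun i r => match a i with inl e => E e r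
  | inr (j, s) => V j (if s then 1 - r else r) end)) => i.
case: (a i) => [e|[j [|]]]; [exact: E_open| |exact: V_open].
suff /continuousP H : continuous (fun r : R => 1 - r) by exact: H.
by move=> r; apply: cvgB; [exact: cvg_cst|exact: cvg_id].
Qed.

End Stars.

Section StarInstances.
Variables (R : realType) (K : cube_complex).
Notation X := (geo R K).

(** Excludes just the opposite end, as in the open star of a cell. *)
Definition near_end (e : bool) : set R := [set r | if e then 0 < r else r < 1].

Lemma near_end_end e (e' : bool) : near_end e e'%:R <-> e = e'.
Proof. by case: e; case: e'; rewrite /near_end /= ?ltr01 ?ltxx. Qed.

Lemma near_end_opp e r : near_end e (1 - r) <-> near_end (~~ e) r.
Proof. by case: e; rewrite /near_end /= ?subr_gt0// ltrBlDr ltrDl. Qed.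

Lemma near_end_open e : open (near_end e).
Proof. by case: e; [exact: open_gt|exact: open_lt]. Qed.

Definition vertex_star (v : K 0%N) : set X := star near_end (fun=> set0) v.

Lemma vertex_star_open v : open (vertex_star v).
Proof.
apply: star_open; [exact: near_end_end|exact: near_end_opp|by move=> j e []|
  exact: near_end_open|move=> j; exact: open0].
Qed.

Lemma vertex_starP v n (c : K n) (x : cube R n) :
  vertex_star v (geo_pt c x) -> exists w, face (cmap_vtx w) c = v.
Proof.
move/starE => H; have [] := H; [exact: near_end_end|exact: near_end_opp|by move=> j e []|].
by move=> a [<- _]; have [w ->] := cmap0P a; exists w.
Qed.

Lemma vertex_star_cover z : exists v, vertex_star v z.
Proof.
elim/geo_ind: z => n c x.
(* A nearest vertex of the cube, with coordinates equal to 1/2 rounded down. *)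
exists (face (cmap_vtx (fun i => 2^-1 < set_val (x i))) c).
apply/starE; [exact: near_end_end|exact: near_end_opp|by move=> j e []|].
exists (cmap_vtx (fun i => 2^-1 < set_val (x i))); split => // i; rewrite ffunE.
rewrite /near_end /=; case: ltP; lra.
Qed.

Fact third_subproof : (3^-1 : R) \in [set x : R | 0 <= x <= 1].
Proof. by apply: mem_set => /=; lra. Qed.
(** A point of the first open half of the edge: unlike the midpoint, it tells an oriented edge from
    its reverse. *)
Definition third_pt : cube R 1 := fun=> exist _ (3^-1 : R) third_subproof.

Definition edge_star (e : K 1%N) : set X :=
  star near_end (fun=> [set r | 0 < r < 2^-1]) e.

Lemma first_half_end (e : bool) : ~ [set r : R | 0 < r < 2^-1] e%:R.
Proof.
case: e => /= /andP[]; rewrite ?ltxx// => _.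
by rewrite (_ : 1%:R = 1)//; lra.
Qed.

Lemma edge_star_open e : open (edge_star e).
Proof.
apply: star_open; [exact: near_end_end|exact: near_end_opp|
  by move=> _; exact: first_half_end|exact: near_end_open|move=> j].
have -> : [set r : R | 0 < r < 2^-1] = [set r | 0 < r] `&` [set r | r < 2^-1].
  by apply/seteqP; split => r /=; [move/andP|move=> ?; apply/andP].
by apply: openI; [exact: open_gt|exact: open_lt].
Qed.

Lemma edge_starE e f : edge_star e (geo_pt f third_pt) <-> f = e.
Proof.
rewrite /edge_star starE; [|exact: near_end_end|exact: near_end_opp|
  by move=> _; exact: first_half_end]; split => [[a [<- H]]|->]; last first.
  exists (cmap_id 1); split; first exact: face_id.
  by move=> i; rewrite ffunE /third_pt set_valE /=; lra.
have [w [i [b aE]]] := cmap1P a.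
rewrite -[LHS]face_id; congr face; rewrite aE; apply: cmapP => j.
have := H j; rewrite aE !ffunE (ord1 j) (ord1 i) /= ffunE addbF.
case: b {aE} => [H'|//]; exfalso; move: H'.
by rewrite /third_pt set_valE /=; lra.
Qed.

(** The star of [d] whose prescribed sets are the single values of [x] need not be open; being well
    defined on the quotient, it transports the coordinates of the point from [d] to [c]. *)
Lemma geo_normal n (c d : K n) (x : cube R n) :
  (forall i, 0 < set_val (x i) < 1) -> geo_pt c x = geo_pt d x ->
  exists a : cmap n n, face a c = d /\ cmap_act a x = x.
Proof.
move=> x01 cd; pose E (e : bool) : set R := [set e%:R].
have E_end e (e' : bool) : E e e'%:R <-> e = e'.
  rewrite /E /=; split => [|->//] /eqP.
  by case: e; case: e' => //; rewrite ?(eq_sym 0) oner_eq0.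
have E_opp e r : E e (1 - r) <-> E (~~ e) r.
  by rewrite /E /=; case: e => /=; split; lra.
pose V i : set R := [set set_val (x i)].
have V_end j (e : bool) : ~ V j e%:R.
  by rewrite /V /= => H; have := x01 j; rewrite -H; case: e {H}; rewrite ltxx ?andbF.
have : star E V d (geo_pt d x).
  apply/starE => //; exists (cmap_id n); split; first exact: face_id.
  by move=> i; rewrite ffunE.
rewrite -cd => /starE-/(_ E_end E_opp V_end)[a [ad H]]; exists a; split => //.
apply: cube_ext => i; apply: ui_inj; rewrite /cmap_act; have := H i.
case: (a i) => [e|[j s]]; first by rewrite /E /= => ->.
by rewrite /V /=; case: s; rewrite ?ui_oppE /=; lra.
Qed.

End StarInstances.

(** * Double coverings of a square *)

Definition lconst (T : topologicalType) (f : T -> bool) (q : T) :=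
  \forall z \near q, f z = f q.

Lemma lconst_near (T : topologicalType) (f g : T -> bool) b q :
  (\forall z \near q, f z = g z (+) b) -> lconst g q -> lconst f q.
Proof.
move=> fg gq; have fgq := nbhs_singleton fg.
by near=> z; rewrite (near fg z)// fgq (near gq z).
Unshelve. all: by end_near. Qed.

Lemma lconst_xor (T : topologicalType) (f g : T -> bool) q :
  lconst f q -> lconst g q -> lconst (fun z => f z (+) g z) q.
Proof.
by move=> fq gq; near=> z; rewrite (near fq z)// (near gq z).
Unshelve. all: by end_near. Qed.

Lemma lconst_cst (T : topologicalType) b (f : T -> bool) q :
  (forall z, f z = b) -> lconst f q.
Proof. by move=> fb; apply: (@filterE _ (nbhs q)) => z; rewrite !fb. Qed.

Lemma lconst_comp (T U : topologicalType) (h : T -> U) (f : U -> bool) q :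
  {for q, continuous h} -> lconst f (h q) -> lconst (f \o h) q.
Proof. by move=> ch fq; exact: (ch _ fq). Qed.

Lemma pair_continuous (T U V : topologicalType) (f : T -> U) (g : T -> V) x :
  {for x, continuous f} -> {for x, continuous g} ->
  {for x, continuous (fun t => (f t, g t))}.
Proof.
move=> cf cg W [[P Q] /= [Pf Qg] PQ].
have H : nbhs x (f @^-1` P `&` g @^-1` Q).
  by apply: filterI; [exact: cf|exact: cg].
suff : nbhs x ((fun t => (f t, g t)) @^-1` W) by [].
by apply: filterS H => t [Pt Qt]; exact: PQ.
Qed.

Section Interval.
Variable R : realType.

Lemma lconst_segment (f : R -> bool) (a b : R) : a <= b ->
  (forall t, a <= t <= b -> lconst f t) -> f a = f b.
Proof.
move=> ab fl; apply: contrapT => fab.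
(* If [f] took different values at the ends, its real-valued copy would take the value 1/2 in
   between. *)
pose g t : R := (f t)%:R.
have gc : {within `[a, b], continuous g}.
  apply: continuous_in_subspaceT => t; rewrite inE /= in_itv /= => /fl ft.
  apply: cvg_near_cst; rewrite /g; near=> z; rewrite (near ft z)//.
have [|c _] := @IVT _ g a b 2^-1 ab gc.
  have h0 : (0 : R) <= 2^-1 by lra.
  have h1 : 2^-1 <= (1 : R) by lra.
  rewrite ge_min le_max /g; move: fab.
  by case: (f a); case: (f b) => //= _; rewrite h0 h1 ?orbT.
by rewrite /g; case: (f c) => /= /eqP; rewrite ?(eq_sym 0) ?(eq_sym 1) ?invr_eq0 ?invr_eq1; lra.
Unshelve. all: by end_near. Qed.

(** Compactness of the segment in the form of an induction: that some [P]-interval reaches from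
    before [a] to beyond [t] is a locally constant condition on [t]. If it holds slightly left of
    [t], one gluing with the local interval at [t] carries it over. *)
Lemma segment_cover (P : R -> R -> Prop) (a b : R) : a <= b ->
  (forall t, a <= t <= b -> exists2 e, 0 < e & P (t - e) (t + e)) ->
  (forall c d c' d', P c d -> P c' d' -> c < c' < d -> d < d' -> P c d') ->
  exists c d, [/\ c < a, b < d & P c d].
Proof.
move=> ab Ploc Pglue.
pose f t := `[< exists c d, [/\ c < a, t < d & P c d] >].
suff : f b by move=> /asboolP.
rewrite -(@lconst_segment f a b ab).
  have [|e e0 Pe] := Ploc a; first by rewrite lexx.
  by apply/asboolP; exists (a - e), (a + e); split => //; lra.
move=> t /Ploc[e e0 Pe]; case ft : (f t) => /=; rewrite /lconst ft.
  have /asboolP[c [d [ca td Pcd]]] := ft.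
  have : \forall z \near t, z < d by apply: lt_nbhsl.
  by apply: filterS => z zd; apply/asboolP; exists c, d.
have : \forall z \near t, t - e < z by apply: lt_nbhsr; lra.
apply: filterS => z zt; apply: contraFF ft => /asboolP[c [d [ca zd Pcd]]].
apply/asboolP; have [td|dt] := ltP t d; first by exists c, d.
have [tc|ct] := leP (t - e) c.
  by exists (t - e), (t + e); split => //; lra.
exists c, (t + e); split => //; first by lra.
by apply: Pglue Pcd Pe _ _; [apply/andP; split|]; lra.
Qed.

End Interval.

Section Square.
Variables (R : realType) (A B : set (R * R)) (f : R * R -> bool).
Hypotheses (oA : open A) (oB : open B) (AB : forall q, A q \/ B q).
Hypothesis f_lconst : forall q, A q -> B q -> lconst f q.

(* A section of the double covering glued from trivial ones over A and B with
   transition function f. *)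
Definition section_at (G : R * R -> bool) q :=
  (A q -> lconst G q) /\ (B q -> lconst (fun z => G z (+) f z) q).

Lemma section_near (G G' : R * R -> bool) b q :
  (\forall z \near q, G z = G' z (+) b) -> section_at G' q -> section_at G q.
Proof.
move=> GG [GA GB]; split => [/GA|/GB]; first exact: lconst_near GG.
apply: (@lconst_near _ _ _ b); apply: filterS GG => z ->.
by rewrite addbAC.
Qed.

(** With two sheets, two sections differ by a function to bool; over [B] the transition function
    cancels in the difference. *)
Lemma section_xor (G G' : R * R -> bool) q :
  section_at G q -> section_at G' q -> lconst (fun z => G z (+) G' z) q.
Proof.
move=> [GA GB] [GA' GB']; have [Aq|Bq] := AB q.
  by apply: lconst_xor; [exact: GA|exact: GA'].
have -> : (fun z => G z (+) G' z) = (fun z => (G z (+) f z) (+) (G' z (+) f z)).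
  by apply/funext => z; rewrite addbACA addbb addbF.
by apply: lconst_xor; [exact: GB|exact: GB'].
Qed.

Definition section_on (a b c d : R) := exists G, forall q : R * R,
  a < q.1 < b -> c < q.2 < d -> section_at G q.

Lemma section_local (q : R * R) : exists2 e, 0 < e &
  section_on (q.1 - e) (q.1 + e) (q.2 - e) (q.2 + e).
Proof.
have H (D : set (R * R)) G : open D -> D q -> (forall z, D z -> section_at G z) ->
    exists2 e, 0 < e & section_on (q.1 - e) (q.1 + e) (q.2 - e) (q.2 + e).
  move=> oD Dq GD; have /nbhs_ballP[e /= e0 eD] : nbhs q D by exact: open_nbhs_nbhs.
  exists e => //; exists G => z z1 z2; apply: GD; apply: eD.
  by split; rewrite /ball /= distrC ltr_distlC; lra.
have [Aq|Bq] := AB q.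
  apply: (H A (fun=> false)) => // z Az; split => [_|Bz]; first exact: lconst_cst.
  exact: f_lconst.
(* A constant section in the chart over [B], read in the chart over [A], is [f] itself. *)
apply: (H B f) => // z Bz; split => [Az|_]; first exact: f_lconst.
by apply: (@lconst_cst _ false) => y; rewrite addbb.
Qed.

(** Shifting [G2] by [b] makes it equal to [G1] near the cut, so that the pasted function is, near
    every point, one of the two sections up to a constant. *)
Lemma section_glue (G1 G2 : R * R -> bool) (b : bool) (h : R * R -> R) (m : R)
    (D : set (R * R)) : continuous h ->
  (forall q, D q -> h q <= m -> section_at G1 q) ->
  (forall q, D q -> m <= h q -> section_at G2 q) ->
  (forall q, D q -> h q = m -> \forall z \near q, G1 z (+) G2 z = b) ->
  exists G, forall q, D q -> section_at G q.
Proof.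
move=> ch s1 s2 s12; exists (fun z => if h z < m then G1 z else G2 z (+) b).
move=> q Dq; have [hq|hq|hq] := ltgtP (h q) m.
- apply: (@section_near _ G1 false); last exact: s1 (ltW hq).
  have : \forall z \near q, h z < m by exact: (ch q _ (lt_nbhsl hq)).
  by apply: filterS => z ->; rewrite addbF.
- apply: (@section_near _ G2 b); last exact: s2 (ltW hq).
  have : \forall z \near q, m < h z by exact: (ch q _ (lt_nbhsr hq)).
  by apply: filterS => z mz; rewrite ltNge (ltW mz).
apply: (@section_near _ G1 false); last by apply: s1; rewrite ?hq.
apply: filterS (s12 _ Dq hq) => z <-; case: ifP; rewrite addbF//.
by rewrite addbCA addbb addbF.
Qed.

(** The cut is made at the middle height [m] of the overlap. There the two sections differ by a
    locally constant function on a segment, hence by the constant read off at its midpoint [x]. *)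
Lemma section_on_snd a b c d c' d' : a < b ->
  section_on a b c d -> section_on a b c' d' -> c < c' < d -> d < d' ->
  section_on a b c d'.
Proof.
move=> ab [G1 s1] [G2 s2] /andP[cc' c'd] dd'.
pose m := (c' + d) / 2; pose x := (a + b) / 2.
suff [G HG] : exists G, forall q, [set q : R * R | a < q.1 < b /\ c < q.2 < d'] q ->
    section_at G q by exists G => q q1 q2; exact: HG.
apply: (@section_glue G1 G2 (G1 (x, m) (+) G2 (x, m)) snd m).
- by move=> z; exact: cvg_snd.
- by move=> q [q1 q2] qm; apply: s1; rewrite /m in qm *; lra.
- by move=> q [q1 q2] qm; apply: s2; rewrite /m in qm *; lra.
move=> [y _] /= [/andP[ay yb] _] ->.
have K t : a < t < b -> lconst (fun z => G1 z (+) G2 z) (t, m).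
  by move=> tab; apply: section_xor; [apply: s1|apply: s2] => //=; rewrite /m; lra.
have Kc t : a < t < b -> lconst (fun t => G1 (t, m) (+) G2 (t, m)) t.
  move=> tab; apply: (@lconst_comp _ _ (fun t => (t, m)) (fun z => G1 z (+) G2 z)).
    by apply: pair_continuous; [exact: cvg_id|exact: cvg_cst].
  exact: K.
have <- : G1 (y, m) (+) G2 (y, m) = G1 (x, m) (+) G2 (x, m); last by apply: K; lra.
have [xy|/ltW yx] := leP x y; [apply/esym|];
  apply: (@lconst_segment _ (fun t => G1 (t, m) (+) G2 (t, m))) => //.
  by move=> t txy; apply: Kc; rewrite /x in txy xy; lra.
by move=> t txy; apply: Kc; rewrite /x in txy yx; lra.
Qed.

Lemma section_on_fst a b a' b' c d : c < d ->
  section_on a b c d -> section_on a' b' c d -> a < a' < b -> b < b' ->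
  section_on a b' c d.
Proof.
move=> cd [G1 s1] [G2 s2] /andP[aa' a'b] bb'.
pose m := (a' + b) / 2; pose x := (c + d) / 2.
suff [G HG] : exists G, forall q, [set q : R * R | a < q.1 < b' /\ c < q.2 < d] q ->
    section_at G q by exists G => q q1 q2; exact: HG.
apply: (@section_glue G1 G2 (G1 (m, x) (+) G2 (m, x)) fst m).
- by move=> z; exact: cvg_fst.
- by move=> q [q1 q2] qm; apply: s1; rewrite /m in qm *; lra.
- by move=> q [q1 q2] qm; apply: s2; rewrite /m in qm *; lra.
move=> [_ y] /= [_ /andP[ay yb]] ->.
have K t : c < t < d -> lconst (fun z => G1 z (+) G2 z) (m, t).
  by move=> tab; apply: section_xor; [apply: s1|apply: s2] => //=; rewrite /m; lra.
have Kc t : c < t < d -> lconst (fun t => G1 (m, t) (+) G2 (m, t)) t.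
  move=> tab; apply: (@lconst_comp _ _ (fun t => (m, t)) (fun z => G1 z (+) G2 z)).
    by apply: pair_continuous; [exact: cvg_cst|exact: cvg_id].
  exact: K.
have <- : G1 (m, y) (+) G2 (m, y) = G1 (m, x) (+) G2 (m, x); last by apply: K; lra.
have [xy|/ltW yx] := leP x y; [apply/esym|];
  apply: (@lconst_segment _ (fun t => G1 (m, t) (+) G2 (m, t))) => //.
  by move=> t txy; apply: Kc; rewrite /x in txy xy; lra.
by move=> t txy; apply: Kc; rewrite /x in txy yx; lra.
Qed.

Lemma section_on_sub a b c d a' b' c' d' : section_on a b c d ->
  a <= a' -> b' <= b -> c <= c' -> d' <= d -> section_on a' b' c' d'.
Proof. by move=> [G HG] ? ? ? ?; exists G => q q1 q2; apply: HG; lra. Qed.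

Lemma section_square : exists G, forall q : R * R,
  0 <= q.1 <= 1 -> 0 <= q.2 <= 1 -> section_at G q.
Proof.
suff [a [b [a0 b1 [_ [c [d [c0 d1 [G HG]]]]]]]] : exists a b, [/\ a < 0, 1 < b &
    a < b /\ exists c d, [/\ c < 0, 1 < d & section_on a b c d]].
  by exists G => q q1 q2; apply: HG; lra.
apply: segment_cover => //; first last.
- move=> a b a' b' [ab [c [d [c0 d1 s]]]] [_ [c' [d' [c'0 d'1 s']]]] /andP[aa' a'b] bb'.
  split; first lra.
  exists (Num.max c c'), (Num.min d d'); rewrite gt_max lt_min c0 c'0 d1 d'1; split => //.
  apply: (@section_on_fst a b a' b') => //; last by rewrite aa'.
  - by rewrite gt_max !lt_min; apply/andP; split; apply/andP; split; lra.
  - by apply: section_on_sub s _ _ _ _; rewrite // ?le_max ?ge_min lexx.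
  - by apply: section_on_sub s' _ _ _ _; rewrite // ?le_max ?ge_min lexx ?orbT.
(* For a fixed first coordinate [s], small rectangles are stacked into a strip of positive width;
   each gluing keeps the smaller width. *)
move=> s _; have [c [d [c0 d1 [e e0 H]]]] : exists c d, [/\ c < 0, 1 < d &
    exists2 e, 0 < e & section_on (s - e) (s + e) c d].
  apply: segment_cover => //.
    by move=> t _; have [e e0 He] := section_local (s, t); exists e => //; exists e.
  move=> c d c' d' [e e0 H] [e' e'0 H'] cc' dd'.
  exists (Num.min e e'); first by rewrite lt_min e0.
  have me : Num.min e e' <= e by rewrite ge_min lexx.
  have me' : Num.min e e' <= e' by rewrite ge_min lexx orbT.
  apply: (section_on_snd _ _ _ cc' dd').
  - by have : 0 < Num.min e e' by [rewrite lt_min e0]; lra.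
  - by apply: section_on_sub H _ _ _ _ => //; lra.
  - by apply: section_on_sub H' _ _ _ _ => //; lra.
by exists e => //; split; [lra|exists c, d].
Qed.

End Square.

(** * Maps from the unit interval *)

Section Continuity.
Variable R : realType.
Notation I := (uinterval R).

Lemma cube_continuous (T : topologicalType) n (u : T -> cube R n) :
  (forall i, continuous (fun t => u t i)) -> continuous u.
Proof.
move=> cu t; apply/cvg_sup => i W [? /= [[U oU <-]]] /= Ut sub.
suff : nbhs t (u @^-1` W) by [].
have H : nbhs t [set s | U (u s i)] by exact: (cu i t U (open_nbhs_nbhs (conj oU Ut))).
by apply: filterS H => s Us; exact: sub.
Qed.

Lemma ui_continuous (T : topologicalType) (u : T -> uinterval R) :
  continuous (fun t => set_val (u t)) -> continuous u.
Proof. exact: continuous_comp_initial. Qed.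

Lemma set_val_continuous : continuous (fun t : I => set_val t : R).
Proof. exact: initial_continuous. Qed.

Lemma affine_continuous (a b : R) : continuous (fun t : I => a * set_val t + b : R).
Proof.
move=> t; apply: (@continuous_comp _ _ _ _ (fun r : R => a * r + b)).
  exact: set_val_continuous.
by apply: cvgD; [apply: cvgM; [exact: cvg_cst|exact: cvg_id]|exact: cvg_cst].
Qed.

Fact clamp_subproof (r : R) : Num.max 0 (Num.min 1 r) \in [set x : R | 0 <= x <= 1].
Proof. by apply: mem_set => /=; rewrite le_max lexx /= ge_max ler01 ge_min lexx. Qed.
(** The retraction of the line onto the interval: it extends maps from the interval and from the
    square to the line and the plane, where the preceding results live. *)
Definition clamp (r : R) : I :=
  exist _ (Num.max 0 (Num.min 1 r) : R) (clamp_subproof r).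

Lemma clampE r : 0 <= r <= 1 -> set_val (clamp r) = r.
Proof. by move=> /andP[r0 r1]; rewrite set_valE /= (min_idPr r1) (max_idPr r0). Qed.

Lemma clamp_val (t : I) : clamp (set_val t) = t.
Proof. by apply: ui_inj; rewrite clampE// ui_ge0 ui_le1. Qed.

Lemma clamp_continuous : continuous clamp.
Proof.
apply: ui_continuous => r.
have -> : (fun t => set_val (clamp t)) = (cst 0 \max (cst 1 \min id)) :> (R -> R).
  by apply/funext => t.
by apply: continuous_max; [exact: cvg_cst|apply: continuous_min; [exact: cvg_cst|exact: cvg_id]].
Qed.

Lemma clamp0 : clamp 0 = zero.
Proof. by apply: ui_inj; rewrite clampE// lexx ler01. Qed.
Lemma clamp1 : clamp 1 = one.
Proof. by apply: ui_inj; rewrite clampE// lexx ler01. Qed.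

Lemma lconst_interval (g : I -> bool) : (forall t, lconst g t) -> g zero = g one.
Proof.
move=> gl; rewrite -clamp0 -clamp1.
apply: (@lconst_segment _ (g \o clamp)) => // t _.
by apply: lconst_comp (gl _); exact: clamp_continuous.
Qed.

Lemma continuous_paste (T U : topologicalType) (h : T -> R) (m : R) (f g : T -> U) :
  continuous h -> continuous f -> continuous g -> (forall t, h t = m -> f t = g t) ->
  continuous (fun t => if h t <= m then f t else g t).
Proof.
move=> ch cf cg fg t W; rewrite /=.
have [ht|ht|ht] := ltgtP (h t) m => Wt.
- have H1 : nbhs t [set s | h s < m] by exact: (ch t _ (lt_nbhsl ht)).
  have H2 : nbhs t [set s | W (f s)] by exact: (cf t).
  apply: (filterS _ (filterI H1 H2)) => s [/ltW] /= hs Ws.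
  by rewrite /= hs.
- have H1 : nbhs t [set s | m < h s] by exact: (ch t _ (lt_nbhsr ht)).
  have H2 : nbhs t [set s | W (g s)] by exact: (cg t).
  apply: (filterS _ (filterI H1 H2)) => s [] /= hs Ws.
  by rewrite /= leNgt hs.
have H1 : nbhs t [set s | W (f s)] by exact: (cf t).
have H2 : nbhs t [set s | W (g s)] by apply: (cg t); rewrite -fg.
apply: (filterS _ (filterI H1 H2)) => s [] /= fs gs /=.
by case: ifP.
Qed.

End Continuity.

(** * Parallelism in faces, and edge paths *)

Section Faces.
Variable K : cube_complex.

Definition orient (s : bool) (e : K 1%N) := if s then rev_edge e else e.

Lemma cell_edge_face m n (a : cmap m n) (c : K n) i j s : a i = inr (j, s) ->
  parallel (cell_edge (face a c) j) (orient s (cell_edge c i)).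
Proof.
move=> aij; pose w k := if cmap_comp a (cmap_edge (fun=> false) j) k is inl e then e else false.
have E : cell_edge (face a c) j = orient s (face (cmap_edge w i) c).
  rewrite /cell_edge /orient /rev_edge -!face_comp cmap_rev_refl.
  case: s aij => aij; rewrite -?face_comp; congr face; apply: cmapP => k.
    rewrite !ffunE /w ffunE; case: (eqVneq k i) => [->|ki].
      by rewrite aij ffunE eqxx /= ffunE.
    case ak : (a k) => [//|[l t]]; rewrite ffunE; case: eqVneq => //= lj.
    have [g Hg] := cmap_pos a; have := Hg k j; have := Hg i j.
    rewrite ak aij /= lj eqxx => /esym/eqP ii /esym/eqP kk.
    by rewrite ii kk eqxx in ki.
  rewrite !ffunE /w ffunE; case: (eqVneq k i) => [->|ki].
    by rewrite aij ffunE eqxx.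
  case ak : (a k) => [//|[l t]]; rewrite ffunE; case: eqVneq => //= lj.
  have [g Hg] := cmap_pos a; have := Hg k j; have := Hg i j.
  rewrite ak aij /= lj eqxx => /esym/eqP ii /esym/eqP kk.
  by rewrite ii kk eqxx in ki.
rewrite E /orient; case: s {aij E}; [apply: parallel_rev|]; exact: parallel_edge.
Qed.

Lemma orient_orient s t (e : K 1%N) : orient s (orient t e) = orient (s (+) t) e.
Proof. by case: s; case: t; rewrite //= rev_edgeK. Qed.

Lemma parallel_orient s (e f : K 1%N) : parallel e f -> parallel (orient s e) (orient s f).
Proof. by case: s => //=; exact: parallel_rev. Qed.

Lemma cell_edge1 (e : K 1%N) i : cell_edge e i = e.
Proof.
rewrite /cell_edge -[RHS]face_id; congr face; apply: cmapP => j.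
by rewrite !ffunE (ord1 i) (ord1 j).
Qed.

Lemma same_hyperplaneP (e f : K 1%N) :
  same_hyperplane e f <-> exists s, parallel e (orient s f).
Proof.
split => [[H|H]|[[] H]]; [by exists false|by exists true|by right|by left].
Qed.

Lemma same_hyperplane_face (e : K 1%N) m n (a : cmap m n) (c : K n) i j s :
  a i = inr (j, s) ->
  same_hyperplane e (cell_edge (face a c) j) <-> same_hyperplane e (cell_edge c i).
Proof.
move=> /(cell_edge_face c) H.
have H' : same_hyperplane (cell_edge (face a c) j) (cell_edge c i).
  by apply/same_hyperplaneP; exists s.
split => E; first exact: same_hyperplane_trans H'.
by apply: same_hyperplane_trans E _; exact: same_hyperplane_sym.
Qed.

(** The boolean is the parity of the number of edges of the path that satisfy [P]. *)
Inductive edge_path (P : K 1%N -> Prop) : K 0%N -> K 0%N -> bool -> Prop :=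
| EdgePathNil v : edge_path P v v false
| EdgePathCons e w b : edge_path P (tgt e) w b ->
    edge_path P (src e) w (`[< P e >] (+) b).

Lemma edge_path_trans P u v w b c :
  edge_path P u v b -> edge_path P v w c -> edge_path P u w (b (+) c).
Proof.
elim=> {u v b} [v//|e v b _ IH /IH H].
by rewrite -addbA; exact: EdgePathCons.
Qed.

Lemma edge_path1 P e : edge_path P (src e) (tgt e) `[< P e >].
Proof. by rewrite -[asbool _]addbF; apply: EdgePathCons; exact: EdgePathNil. Qed.

Definition path_connected v w := exists b, edge_path (fun=> False) v w b.

Lemma path_connected_refl v : path_connected v v.
Proof. by exists false; constructor. Qed.

Lemma path_connected_trans v u w :
  path_connected u v -> path_connected v w -> path_connected u w.
Proof. by move=> [b H] [c H']; exists (b (+) c); exact: edge_path_trans H'. Qed.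

Lemma path_connected_edge e : path_connected (src e) (tgt e).
Proof. by exists `[< False >]; exact: edge_path1. Qed.

Lemma path_connected_sym v w : path_connected v w -> path_connected w v.
Proof.
move=> [b]; elim=> {v w b} [v|e w b _ H]; first exact: path_connected_refl.
apply: path_connected_trans H _.
by rewrite -[X in path_connected X]src_rev -[X in path_connected _ X]tgt_rev;
  exact: path_connected_edge.
Qed.

Lemma edge_path_of P v w : path_connected v w -> exists b, edge_path P v w b.
Proof.
move=> [b]; elim=> {v w b} [v|e w b _ [c H]]; first by exists false; constructor.
by exists (`[< P e >] (+) c); constructor.
Qed.

Lemma vertex_upd (T : Type) (F : K 0%N -> T) n (c : K n) (w w' : 'I_n -> bool) :
  (forall u i, w i != w' i -> F (face (cmap_vtx (upd u i false)) c) =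
                              F (face (cmap_vtx (upd u i true)) c)) ->
  F (face (cmap_vtx w) c) = F (face (cmap_vtx w') c).
Proof.
move=> H; pose v (m : nat) (j : 'I_n) := if (j < m)%N then w j else w' j.
suff K' m : F (face (cmap_vtx (v m)) c) = F (face (cmap_vtx w') c).
  have <- // : cmap_vtx (v n) = cmap_vtx w.
  by apply: cmap_vtx_ext => j; rewrite /v ltn_ord.
elim: m => [|m IH]; first by congr (F (face _ _)); exact: cmap_vtx_ext.
case: (ltnP m n) => [mn|nm]; last first.
  have -> // : cmap_vtx (v m.+1) = cmap_vtx (v m).
  apply: cmap_vtx_ext => j; rewrite /v.
  by rewrite !(leq_trans (ltn_ord j))// ltnW.
pose k := Ordinal mn.
have E1 : cmap_vtx (v m.+1) = cmap_vtx (upd (v m) k (w k)).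
  apply: cmap_vtx_ext => j; rewrite /v /upd -val_eqE /= ltnS leq_eqVlt.
  by case: eqVneq => //= E; congr w; apply: val_inj.
have E2 : cmap_vtx (v m) = cmap_vtx (upd (v m) k (w' k)).
  apply: cmap_vtx_ext => j; rewrite /v /upd -val_eqE /=.
  by case: eqVneq => //= E; rewrite E ltnn; congr w'; apply: val_inj.
rewrite -IH E1 [in RHS]E2; have := H (v m) k.
by case: (w k); case: (w' k) => // ->.
Qed.

Lemma path_connected_cell n (c : K n) w w' :
  path_connected (face (cmap_vtx w) c) (face (cmap_vtx w') c).
Proof.
pose F v := `[< path_connected v (face (cmap_vtx w') c) >].
suff : F (face (cmap_vtx w) c) by move=> /asboolP.
rewrite (@vertex_upd _ F _ c w w'); first by apply/asboolP; exact: path_connected_refl.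
move=> u i _; rewrite -src_edge -tgt_edge; set e := face _ _.
apply/asboolP/asboolP => H; apply: path_connected_trans H.
  by apply: path_connected_sym; exact: path_connected_edge.
exact: path_connected_edge.
Qed.

End Faces.

(** * Parity of crossings *)

Section Crossing.
Variables (R : realType) (K : cube_complex) (e0 : K 1%N).
Notation X := (geo R K).
Notation I := (uinterval R).
Notation dual e := (same_hyperplane e0 e).

Hypothesis embedded : forall e f : K 1%N, dual e -> dual f -> ~ corner e f.
Hypothesis two_sided : ~ parallel e0 (rev_edge e0).

(* W restricts the coordinate transverse to the hyperplane dual to e0, oriented
   in the direction of e0. *)
Definition crossing_cond (W : set R) n (c : K n) (x : cube R n) := exists i s,
  parallel e0 (orient s (cell_edge c i)) /\
  W (if s then 1 - set_val (x i) else set_val (x i)).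

Definition crossing (W : set R) : set X := gset (crossing_cond W).

Lemma dual_dir_inj n (c : K n) i j :
  dual (cell_edge c i) -> dual (cell_edge c j) -> i = j.
Proof.
move=> di dj; apply/eqP; apply: contraT => ij; exfalso.
exact: (embedded di dj (corner_cell c ij)).
Qed.

Lemma parallel_orient_inj e s t :
  parallel e0 (orient s e) -> parallel e0 (orient t e) -> s = t.
Proof.
move=> es et; case: (eqVneq s t) => // st; exfalso; apply: two_sided.
apply: (parallel_trans es); have /= := @parallel_orient K true _ _ et.
have -> : rev_edge (orient t e) = orient s e.
  rewrite -[LHS]/(orient true (orient t e)) orient_orient.
  by case: s t st {es et} => -[].
exact: parallel_sym.
Qed.

(** Either the transverse coordinate survives in the face, up to a reflection recorded in the
    orientation, or it is constant there, equal to an end, and [W] avoids the ends. *)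
Lemma crossing_saturated (W : set R) : (forall e : bool, ~ W e%:R) ->
  saturated (crossing_cond W).
Proof.
move=> W_end m n a c x; split => -[i [s [p Wi]]].
  have [g Hg] := cmap_pos a; have := Hg (g i) i; rewrite eqxx.
  case aE : (a (g i)) => [//|[j t]] /= /eqP ij; rewrite {j}ij in aE.
  exists (g i), (s (+) t); split.
    apply: parallel_trans p _; rewrite -orient_orient; apply: parallel_orient.
    exact: cell_edge_face aE.
  by rewrite /cmap_act aE; move: Wi; case: s {p}; case: t {aE} => //=; rewrite subKr.
move: Wi; rewrite /cmap_act; case aE : (a i) => [e|[j t]].
  rewrite ui_boolE => H; exfalso; case: s {p} H => [|/W_end//].
  have -> : 1 - e%:R = (~~ e)%:R :> R by case: e {aE}; rewrite ?subrr ?subr0.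
  by move/W_end.
move=> Wi; exists j, (s (+) t); split; last first.
  by move: Wi; case: s {p}; case: t {aE} => //=; rewrite subKr.
apply: parallel_trans p _; rewrite -orient_orient; apply: parallel_orient.
have := parallel_orient t (cell_edge_face c aE).
by rewrite orient_orient addbb => /parallel_sym.
Qed.

Lemma crossingE (W : set R) : (forall e : bool, ~ W e%:R) ->
  forall n (c : K n) (x : cube R n), crossing W (geo_pt c x) <-> crossing_cond W c x.
Proof. by move=> W_end; apply: gsetE; exact: crossing_saturated. Qed.

Lemma open_reflect (W : set R) (s : bool) : open W ->
  open [set r : R | W (if s then 1 - r else r)].
Proof.
case: s => //= oW; suff /continuousP H : continuous (fun r : R => 1 - r) by exact: H.
by move=> r; apply: cvgB; [exact: cvg_cst|exact: cvg_id].
Qed.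

Lemma crossing_open (W : set R) : (forall e : bool, ~ W e%:R) -> open W ->
  open (crossing W).
Proof.
move=> W_end oW; apply: gset_open; first exact: crossing_saturated.
move=> n c; have -> : [set x : cube R n | crossing_cond W c x] =
    \bigcup_(p in [set p : 'I_n * bool | parallel e0 (orient p.2 (cell_edge c p.1))])
      [set x : cube R n | W (if p.2 then 1 - set_val (x p.1) else set_val (x p.1))].
  apply/seteqP; split => x /=; first by move=> [i [s [p Wi]]]; exists (i, s).
  by move=> [[i s] /= p Wi]; exists i, s.
apply: bigcup_open => -[i s] _ /=.
have /continuousP H := cube_coord_continuous (R := R) (i := i).
exact: H _ (open_reflect (s := s) oW).
Qed.

(** The transverse coordinate is well defined: embeddedness leaves one dual direction in a cube, and
    two-sidedness one orientation of it. *)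
Lemma crossing_disjoint (W W' : set R) z :
  (forall e : bool, ~ W e%:R) -> (forall e : bool, ~ W' e%:R) ->
  (forall r, W r -> ~ W' r) -> crossing W z -> ~ crossing W' z.
Proof.
move=> W_end W'_end WW'; elim/geo_ind: z => n c x.
rewrite !crossingE// => -[i [s [p Wi]]] [j [t [q Wj]]].
have ij : i = j by apply: (@dual_dir_inj _ c); apply/same_hyperplaneP; [exists s|exists t].
rewrite -{j}ij in q Wj; rewrite -(parallel_orient_inj p q) in Wj.
exact: WW' Wi Wj.
Qed.

Let mid : set R := [set 2^-1].
Let mid_end (e : bool) : ~ mid e%:R.
Proof.
rewrite /mid /= => E; have : 0 < (2^-1 : R) < 1 by lra.
by rewrite -E; case: e {E}; rewrite /= ltxx ?andbF.
Qed.

Lemma hyperplaneE : hyperplane e0 = crossing mid.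
Proof.
apply/seteqP; split => z.
  move=> [n [c [x [i [-> xi /same_hyperplaneP[s p]]]]]]; apply/crossingE => //.
  by exists i, s; split => //; rewrite /mid /= xi; case: s {p}; lra.
elim/geo_ind: z => n c x /crossingE-/(_ mid_end)[i [s [p xi]]].
exists n, c, x, i; split => //; last by apply/same_hyperplaneP; exists s.
by move: xi; rewrite /mid /=; case: s {p}; lra.
Qed.

Lemma open_hyperplaneC : open (~` hyperplane e0 : set X).
Proof.
rewrite hyperplaneE; apply: geo_open => n c.
have -> : [set x : cube R n | (~` crossing mid) (geo_pt c x)] =
    [set x : cube R n | forall i, [set r | dual (cell_edge c i) -> r != 2^-1] (set_val (x i))].
  apply/seteqP; split => x /=; rewrite crossingE// => H.
    move=> i /same_hyperplaneP[s p]; apply/eqP => xi; apply: H.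
    by exists i, s; split => //; rewrite /mid /= xi; case: s {p}; lra.
  move=> [i [s [p xi]]]; have d : dual (cell_edge c i) by apply/same_hyperplaneP; exists s.
  have /eqP := H i d; apply.
  by move: xi; rewrite /mid /=; case: s {p}; lra.
apply: (@open_cube R n (fun i => [set r | dual (cell_edge c i) -> r != 2^-1])) => i.
have [d|nd] := pselect (dual (cell_edge c i)); last first.
  have -> : [set r : R | dual (cell_edge c i) -> r != 2^-1] = setT.
    by apply/seteqP; split => // r _ /nd.
  exact: openT.
have -> : [set r : R | dual (cell_edge c i) -> r != 2^-1] = ~` [set 2^-1].
  apply/seteqP; split => r /=; first by move=> /(_ d)/eqP.
  by move=> /eqP.
apply: closed_openC; exact: closed_eq.
Qed.

Let inside : set R := [set r | 0 < r < 1].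
Let lower : set R := [set r | 0 < r < 2^-1].
Let upper : set R := [set r | 2^-1 < r < 1].
Let inside_end (e : bool) : ~ inside e%:R.
Proof. by rewrite /inside /=; case: e; rewrite /= ltxx ?andbF. Qed.
Let lower_end (e : bool) : ~ lower e%:R.
Proof. exact: first_half_end. Qed.
Let upper_end (e : bool) : ~ upper e%:R.
Proof.
by rewrite /upper /=; case: e; rewrite /= ?ltxx ?andbF// => /andP[]; rewrite invr_lt0 ltrn0.
Qed.

Let open_between (a b : R) : open [set r : R | a < r < b].
Proof.
have -> : [set r : R | a < r < b] = [set r | a < r] `&` [set r | r < b].
  by apply/seteqP; split => r /=; [move/andP|move=> ?; apply/andP].
by apply: openI; [exact: open_gt|exact: open_lt].
Qed.

(** The charts of the double covering are the complement of the hyperplane and its open carrier.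
    They overlap in the lower and the upper half of the carrier, and the sheets are exchanged on the
    upper half only. *)
Let A : set X := ~` hyperplane e0.
Let B : set X := crossing inside.
Let f (z : X) := `[< crossing upper z >].

Let AB z : A z \/ B z.
Proof.
have [H|H] := pselect (hyperplane e0 z); [right|by left].
move: H; rewrite hyperplaneE; elim/geo_ind: z => n c x.
rewrite /B !crossingE// => -[i [s [p xi]]]; exists i, s; split => //.
by move: xi; rewrite /mid /inside /= => ->; lra.
Qed.

Let f_lconst z : A z -> B z -> lconst f z.
Proof.
move=> Az Bz.
have [u|nu] := pselect (crossing upper z).
  have : nbhs z (crossing upper).
    by apply: open_nbhs_nbhs; split => //; apply: crossing_open => //; exact: open_between.
  by apply: filterS => y uy; rewrite /f; apply/asboolP/asboolP.
have l : crossing lower z.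
  move: Az Bz nu; rewrite /A /B /= hyperplaneE; elim/geo_ind: z => n c x.
  rewrite !crossingE// => xm [i [s [p xi]]] xu.
  exists i, s; split => //; move: xi; rewrite /inside /lower /= => /andP[x0 x1].
  rewrite x0 /=; case: ltgtP => // xx; exfalso; [apply: xu|apply: xm];
    by exists i, s; split => //; rewrite /upper /= xx.
have : nbhs z (crossing lower).
  by apply: open_nbhs_nbhs; split => //; apply: crossing_open => //; exact: open_between.
have H y : crossing lower y -> f y = false.
  move=> ly; apply/negbTE/negP => /asboolP; apply: crossing_disjoint ly => //.
  by move=> r; rewrite /lower /upper /=; lra.
by apply: filterS => y ly; rewrite !H.
Qed.

(* A section along p of the double covering whose two sheets are exchanged by
   crossing the hyperplane. *)
Definition path_section (T : topologicalType) (p : T -> X) (g : T -> bool) t :=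
  (A (p t) -> lconst g t) /\ (B (p t) -> lconst (fun z => g z (+) f (p z)) t).

Lemma path_section_comp (T U : topologicalType) (h : U -> T) (p : T -> X) g t :
  {for t, continuous h} -> path_section p g (h t) -> path_section (p \o h) (g \o h) t.
Proof.
move=> ch [sA sB]; split => [/sA|/sB].
  exact: lconst_comp.
exact: (@lconst_comp _ _ h (fun z => g z (+) f (p z))).
Qed.

Lemma path_section_cst (T : topologicalType) (p : T -> X) g :
  (forall t t', p t = p t') -> (forall t, path_section p g t) -> forall t, lconst g t.
Proof.
move=> pc sg t; have [sA sB] := sg t; have [/sA//|/sB] := AB (p t).
move=> H; apply: (@lconst_near _ _ (fun z => g z (+) f (p z)) (f (p t))) => //.
by apply: filterE => z; rewrite (pc z t) addbK.
Qed.

(** A section over the square of a contraction restricts to one along the loop. On the three other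
    sides the contraction stays at [x], so the section is constant there, and these sides join the
    two ends of the loop. *)
Lemma loop_section (x : X) (p : I -> X) : simply_connected R X ->
  continuous p -> p zero = x -> p one = x ->
  exists2 g, (forall t, path_section p g t) & g zero = g one.
Proof.
move=> [_ sc] cp p0 p1.
have [H [cH H0 H1 H2]] := sc x (mk_path cp p0 p1).
pose h (q : R * R) := (clamp q.1, clamp q.2).
have ch : continuous h.
  move=> q; apply: (@pair_continuous _ _ _ (fun q => clamp q.1) (fun q => clamp q.2) q).
    by apply: (@continuous_comp _ _ _ fst) => //; [exact: cvg_fst|exact: clamp_continuous].
  by apply: (@continuous_comp _ _ _ snd) => //; [exact: cvg_snd|exact: clamp_continuous].
pose P := H \o h.
have cP : continuous P.
  by move=> q; apply: continuous_comp; [exact: ch|exact: cH].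
have [| | | |G HG] := @section_square R (P @^-1` A) (P @^-1` B) (f \o P).
- by move/continuousP: cP; apply; exact: open_hyperplaneC.
- by move/continuousP: cP; apply; apply: crossing_open => //; exact: open_between.
- by move=> q; exact: AB.
- by move=> q Aq Bq; apply: lconst_comp; [exact: cP|exact: f_lconst].
have vI (t : I) : 0 <= set_val t <= 1 by rewrite ui_ge0 ui_le1.
have [I0 I1] : (0 <= (0 : R) <= 1) /\ (0 <= (1 : R) <= 1) by rewrite !lexx ler01.
have HG' (k : I -> R * R) (t : I) : continuous k -> 0 <= (k t).1 <= 1 -> 0 <= (k t).2 <= 1 ->
    path_section (P \o k) (G \o k) t.
  by move=> ck k1 k2; apply: path_section_comp; [exact: ck|exact: HG].
have cpair (u v : I -> R) : continuous u -> continuous v -> continuous (fun t => (u t, v t)).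
  by move=> cu cv t; apply: pair_continuous; [exact: cu|exact: cv].
have cv := @set_val_continuous R.
have cc (r : R) : continuous (fun _ : I => r) by exact: cst_continuous.
exists (fun t => G (0, set_val t)).
  move=> t; have -> : p = P \o (fun t => (0, set_val t)).
    by apply/funext => u; rewrite /P /h /= clamp0 clamp_val H0.
  by apply: HG' => /=; [exact: cpair|exact: I0|exact: vI].
have cst (k : I -> R * R) : continuous k -> (forall t, 0 <= (k t).1 <= 1) ->
    (forall t, 0 <= (k t).2 <= 1) -> (forall t, P (k t) = x) -> G (k zero) = G (k one).
  move=> ck k1 k2 Pk; apply: (@lconst_interval _ (G \o k)).
  apply: (@path_section_cst _ (P \o k)); first by move=> t t' /=; rewrite !Pk.
  by move=> t; exact: HG'.
have z0 : set_val (zero : I) = 0 by [].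
have z1 : set_val (one : I) = 1 by [].
have E1 : G (0, 0) = G (1, 0).
  apply: (@cst (fun t => (set_val t, 0))) => [|t|t|t] /=.
  - exact: cpair.
  - exact: vI.
  - exact: I0.
  by rewrite /P /h /= clamp0; have [] := H2 (clamp (set_val t)).
have E2 : G (1, 0) = G (1, 1).
  apply: (@cst (fun t => (1, set_val t))) => [|t|t|t] /=.
  - exact: cpair.
  - exact: I1.
  - exact: vI.
  by rewrite /P /h /= clamp1 H1.
have E3 : G (0, 1) = G (1, 1).
  apply: (@cst (fun t => (set_val t, 1))) => [|t|t|t] /=.
  - exact: cpair.
  - exact: vI.
  - exact: I1.
  by rewrite /P /h /= clamp1; have [] := H2 (clamp (set_val t)).
by rewrite z0 z1 E1 E2 E3.
Qed.

Definition vpt (v : K 0%N) : X := geo_pt v (fun i : 'I_0 => zero).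

Definition edge_curve (e : K 1%N) (t : I) : X := geo_pt e (fun _ : 'I_1 => t).

Lemma edge_curve_continuous e : continuous (edge_curve e).
Proof.
move=> t; apply: (@continuous_comp _ _ _ (fun t : I => (fun _ : 'I_1 => t) : cube R 1)).
  by apply: cube_continuous => i s; exact: cvg_id.
exact: geo_pt_continuous.
Qed.

Lemma edge_curve0 e : edge_curve e zero = vpt (src e).
Proof.
rewrite /vpt /src geo_glue; congr geo_pt; apply: cube_ext => i.
by rewrite /cmap_act ffunE.
Qed.

Lemma edge_curve1 e : edge_curve e one = vpt (tgt e).
Proof.
rewrite /vpt /tgt geo_glue; congr geo_pt; apply: cube_ext => i.
by rewrite /cmap_act ffunE.
Qed.

Lemma edge_curve_parity e g : (forall t, path_section (edge_curve e) g t) ->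
  g zero (+) g one = `[< dual e >].
Proof.
move=> sg; case: asboolP => [/same_hyperplaneP[s p]|nd]; last first.
  rewrite (@lconst_interval _ g) ?addbb// => t; have [+ _] := sg t; apply.
  rewrite /A /= hyperplaneE crossingE// => -[i [s [q _]]].
  by apply: nd; apply/same_hyperplaneP; exists s; rewrite cell_edge1 in q.
have curveE W : (forall b : bool, ~ W b%:R) -> forall t,
    crossing W (edge_curve e t) <-> W (if s then 1 - set_val t else set_val t).
  move=> W_end t; rewrite crossingE//; split => [[i [s' [q Wt]]]|Wt].
    by rewrite cell_edge1 in q; rewrite (parallel_orient_inj p q).
  by exists ord0, s; rewrite cell_edge1.
pose u (t : I) : R := if s then 1 - set_val t else set_val t.
have cu : continuous u.
  rewrite /u; case: s {p curveE u} => /=; last exact: set_val_continuous.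
  have -> : (fun t : I => 1 - set_val t) = (fun t : I => -1 * set_val t + 1 : R).
    by apply/funext => t; rewrite mulN1r addrC.
  exact: affine_continuous.
(* Off the midpoint [g] and [k] are both locally constant; near the midpoint [k] is the transition
   function. Hence [g] jumps exactly where [k] does, namely once. *)
pose k t := 2^-1 < u t.
have nbu t (W : set R) : open W -> W (u t) -> nbhs t [set y | W (u y)].
  by move=> oW Wt; exact: (cu t _ (open_nbhs_nbhs (conj oW Wt))).
have kl t : lconst (fun z => g z (+) k z) t.
  have [sA sB] := sg t; have [ut|ut|ut] := ltgtP (u t) 2^-1.
  - apply: lconst_xor.
      apply: sA; rewrite /A /= hyperplaneE curveE// /mid /=.
      by rewrite -/(u t) => E; rewrite E ltxx in ut.
    apply: filterS (nbu t _ (@open_lt _ 2^-1) ut) => z /= uz.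
    by rewrite /k !ltNge (ltW uz) (ltW ut).
  - apply: lconst_xor.
      apply: sA; rewrite /A /= hyperplaneE curveE// /mid /=.
      by rewrite -/(u t) => E; rewrite E ltxx in ut.
    by apply: filterS (nbu t _ (@open_gt _ 2^-1) ut) => z /= uz; rewrite /k uz ut.
  have /sB : B (edge_curve e t).
    by rewrite /B curveE// /inside /= -/(u t) ut; lra.
  apply: (@lconst_near _ _ _ false); have u1 : u t < 1 by rewrite ut; lra.
  apply: filterS (nbu t _ (@open_lt _ 1) u1) => z /= uz.
  rewrite addbF; congr (_ (+) _); rewrite /k /f; apply/idP/asboolP.
    by rewrite curveE// /upper /= -/(u z) uz andbT.
  by rewrite curveE// /upper /= -/(u z) => /andP[].
have := lconst_interval kl; rewrite /k /u.
have -> : set_val (zero : I) = 0 by [].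
have -> : set_val (one : I) = 1 by [].
have h : (2^-1 < 1 :> R) by lra.
have h' : (2^-1 < 0 :> R) = false by apply/negbTE; rewrite -leNgt; lra.
by case: s {p curveE u cu k nbu kl}; rewrite ?subrr ?subr0 h h';
  case: (g zero); case: (g one).
Qed.

Lemma edge_path_curve v w b : edge_path (fun e => dual e) v w b ->
  exists p : I -> X, [/\ continuous p, p zero = vpt v, p one = vpt w &
    forall g, (forall t, path_section p g t) -> g zero (+) g one = b].
Proof.
elim=> {v w b} [v|e w b' _ [p [cp p0 p1 IH]]].
  exists (fun=> vpt v); split => // [t|g sg]; first exact: cst_continuous.
  rewrite (@lconst_interval _ g) ?addbb//.
  exact: (@path_section_cst _ (fun=> vpt v)).
pose h1 (t : I) := clamp (2 * set_val t); pose h2 (t : I) := clamp (2 * set_val t - 1).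
have caff a b : continuous (fun t : I => clamp (a * set_val t + b)).
  move=> t; apply: (@continuous_comp _ _ _ (fun t : I => a * set_val t + b : R)).
    exact: affine_continuous.
  exact: clamp_continuous.
have ch1 : continuous h1.
  by rewrite (_ : h1 = fun t => clamp (2 * set_val t + 0)) //;
    apply/funext => t; rewrite addr0.
have ch2 : continuous h2 by exact: caff.
pose q t := if set_val t <= 2^-1 then edge_curve e (h1 t) else p (h2 t).
have cq : continuous q.
  apply: continuous_paste.
  - exact: set_val_continuous.
  - by move=> t; apply: continuous_comp; [exact: ch1|exact: edge_curve_continuous].
  - by move=> t; apply: continuous_comp; [exact: ch2|exact: cp].
  move=> t tE; rewrite /h1 /h2 tE mulfV// subrr clamp0 clamp1.
  by rewrite p0 edge_curve1.
have k1 (t : I) : 0 <= set_val t / 2 <= 1 by have := ui_ge0 t; have := ui_le1 t; lra.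
have k2 (t : I) : 0 <= (set_val t + 1) / 2 <= 1.
  by have := ui_ge0 t; have := ui_le1 t; lra.
have ck1 : continuous (fun t : I => clamp (set_val t / 2)).
  rewrite (_ : (fun t => _) = fun t : I => clamp (2^-1 * set_val t + 0))//.
  by apply/funext => t; rewrite addr0 mulrC.
have ck2 : continuous (fun t : I => clamp ((set_val t + 1) / 2)).
  rewrite (_ : (fun t => _) = fun t : I => clamp (2^-1 * set_val t + 2^-1))//.
  by apply/funext => t; rewrite mulrDl mul1r mulrC.
(* The inverse reparametrizations recover the two pieces from [q], so that a section along [q]
   restricts to a section along each of them. *)
have qk1 : q \o (fun t : I => clamp (set_val t / 2)) = edge_curve e.
  apply/funext => t; rewrite /= /q clampE// ifT; last by have := ui_le1 t; lra.
  by rewrite /h1 clampE// mulrC divfK// clamp_val.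
have qk2 : q \o (fun t : I => clamp ((set_val t + 1) / 2)) = p.
  apply/funext => t; rewrite /= /q clampE//; case: leP => tt.
    have t0 : set_val t = 0 by have := ui_ge0 t; lra.
    rewrite /h1 clampE// t0 add0r mul1r mulfV// clamp1 edge_curve1 -p0.
    by congr p; apply: ui_inj; rewrite t0.
  by rewrite /h2 clampE// mulrC divfK// addrK clamp_val.
have z0 : set_val (zero : I) = 0 by [].
have z1 : set_val (one : I) = 1 by [].
exists q; split => //.
- by rewrite -edge_curve0 -[in RHS]qk1 /= z0 mul0r clamp0.
- by rewrite -p1 -[in RHS]qk2 /= z1 -[1 + 1]/(2 : R) mulfV// clamp1.
move=> g sg.
rewrite -(@edge_curve_parity e (g \o (fun t : I => clamp (set_val t / 2)))); last first.
  by move=> t; rewrite -qk1; apply: path_section_comp; [exact: ck1|exact: sg].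
rewrite -(IH (g \o (fun t : I => clamp ((set_val t + 1) / 2)))); last first.
  by move=> t; rewrite -qk2; apply: path_section_comp; [exact: ck2|exact: sg].
rewrite /= z0 z1 add0r mul0r mul1r -[1 + 1]/(2 : R) mulfV// clamp0 clamp1.
by rewrite addbA; congr (_ (+) _); rewrite -addbA addbb addbF.
Qed.

Hypothesis sc : simply_connected R X.

Lemma edge_loop_even v b : edge_path (fun e => dual e) v v b -> b = false.
Proof.
move=> /edge_path_curve[p [cp p0 p1 H]].
by have [g /H <- ->] := loop_section sc cp p0 p1; rewrite addbb.
Qed.

End Crossing.

(** * Halfspaces and the splitting of automorphisms *)

Section Automorphisms.
Variable K : cube_complex.

Lemma auto_inv (g : cube_hom K K) : is_auto g -> exists h : cube_hom K K,
  [/\ is_auto h, forall n (c : K n), h n (g n c) = c & forall n (c : K n), g n (h n c) = c].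
Proof.
move=> ga.
have /cid[h H] : exists h : forall n, K n -> K n,
    forall n, cancel (@hom_fun _ _ g n) (h n) /\ cancel (h n) (@hom_fun _ _ g n).
  suff hn n : {h : K n -> K n | cancel (@hom_fun _ _ g n) h /\ cancel h (@hom_fun _ _ g n)}.
    by exists (fun n => sval (hn n)) => n; case: (hn n).
  by apply: cid; have [h h1 h2] := ga n; exists h.
have hf m n (a : cmap m n) (c : K n) : h m (face a c) = face a (h n c).
  have [H1 H2] := H n; have [H3 _] := H m.
  by rewrite -{1}(H2 c) -hom_face H3.
exists (Defs.Hom hf); split=> [n|n c|n c] /=.
- by have [? ?] := H n; exists (@hom_fun _ _ g n).
- by have [->] := H n.
- by have [_ ->] := H n.
Qed.

Lemma geo_map_id (R : realType) (g : cube_hom K K) : (forall n (c : K n), g n c = c) ->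
  geo_map g = idfun :> (geo R K -> geo R K).
Proof.
by move=> H; apply/funext => z; elim/geo_ind: z => n c x; rewrite geo_mapE H.
Qed.

Definition hom_id : cube_hom K K := @Defs.Hom K K (fun _ c => c) (fun _ _ _ _ => erefl).

Definition hom_comp (g f : cube_hom K K) : cube_hom K K.
Proof.
exists (fun n c => g n (f n c)) => m n a c; by rewrite !hom_face.
Defined.

End Automorphisms.

Section Potential.
Variables (R : realType) (K : cube_complex).
Notation X := (geo R K).
Notation I := (uinterval R).
Hypothesis sc : simply_connected R X.

Lemma cell_vtx_face m n (a : cmap m n) (c : K n) :
  exists w, cell_vtx (face a c) = face (cmap_vtx w) c.
Proof.
rewrite /cell_vtx -face_comp.
by have [w ->] := cmap0P (cmap_comp a (cmap_vtx (fun=> false))); exists w.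
Qed.

(** Being in a cube whose vertices can be reached from [v] does not depend on the position in the
    cube, so it is an open condition, and so is its negation. Along a continuous path it cannot
    change. *)
Lemma vertices_connected (v w : K 0%N) : path_connected v w.
Proof.
pose P n (c : K n) (x : cube R n) := path_connected v (cell_vtx c).
have sP : saturated P.
  move=> m n a c x; rewrite /P; have [u ->] := cell_vtx_face a c.
  by split => H; apply: path_connected_trans H _; exact: path_connected_cell.
have sP' : saturated (fun n c x => ~ P n c x) by move=> m n a c x; rewrite (sP m n a c x).
have open_cst n (Q : Prop) : open [set _ : cube R n | Q].
  have [q|q] := pselect Q.
    by rewrite (_ : [set _ | Q] = setT) ?predeqE//; exact: openT.
  by rewrite (_ : [set _ | Q] = set0) ?predeqE//; exact: open0.
have [/(_ (vpt R v) (vpt R w))[p _] _] := sc.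
pose k (t : I) := `[< gset P (p t) >].
have cp : continuous p by exact: cts_fun.
have kl t : lconst k t.
  suff : lconst (fun z : X => `[< gset P z >]) (p t).
    by move=> /(@lconst_comp _ _ p _ t); apply; exact: cp.
  have [Pz|nPz] := pselect (gset P (p t)).
    have : nbhs (p t) (gset P).
      by apply: open_nbhs_nbhs; split => //; apply: gset_open => // n c; exact: open_cst.
    by apply: filterS => z Pz'; apply/asboolP/asboolP.
  have PC z : ~ gset P z -> gset (fun n c x => ~ P n c x) z.
    by elim/geo_ind: z => n c x; rewrite !gsetE.
  have : nbhs (p t) (gset (fun n c x => ~ P n c x)).
    apply: open_nbhs_nbhs; split; last exact: PC.
    apply: gset_open => // n c.
    exact: (open_cst n (~ path_connected v (cell_vtx c))).
  have CP z : gset (fun n c x => ~ P n c x) z -> ~ gset P z.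
    by elim/geo_ind: z => n c x; rewrite !gsetE.
  by apply: filterS => z /CP nPz'; rewrite !asboolF.
have := lconst_interval kl; rewrite /k path_zero path_one.
have cv u : cell_vtx u = u.
  by rewrite /cell_vtx -[RHS]face_id; congr face; apply: cmapP => -[].
have -> : `[< gset P (vpt R v) >] = true.
  by apply/asboolP; rewrite gsetE// /P cv; exact: path_connected_refl.
by move/esym/asboolP; rewrite gsetE// /P cv.
Qed.

Variable e0 : K 1%N.
Notation dual e := (same_hyperplane e0 e).

(* s tells the two sides of the hyperplane dual to e0 apart. *)
Definition potential (s : K 0%N -> bool) :=
  forall e, s (tgt e) = s (src e) (+) `[< dual e >].

Lemma potential_unique s s' : potential s -> potential s' ->
  exists b, forall v, s' v = s v (+) b.
Proof.
move=> ps ps'; have H v w : path_connected v w -> s v (+) s' v = s w (+) s' w.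
  move=> [b]; elim=> {v w b} [//|e w b _ <-].
  by rewrite ps ps' addbACA addbb addbF.
exists (s (src e0) (+) s' (src e0)) => v.
by rewrite -(H v _ (vertices_connected _ _)) addKb.
Qed.

Hypothesis embedded : forall e f : K 1%N, dual e -> dual f -> ~ corner e f.
Hypothesis two_sided : ~ parallel e0 (rev_edge e0).

Lemma potential_exists : exists s, potential s.
Proof.
pose ep v w b := edge_path (fun e => dual e) v w b.
have ex v w : exists b, ep v w b by apply: edge_path_of; exact: vertices_connected.
have uniq v w b c : ep v w b -> ep v w c -> b = c.
  (* Closing both paths with one return path gives two loops, both of even parity. *)
  move=> vb vc; have [d wd] := ex w v.
  have := edge_loop_even embedded two_sided sc (edge_path_trans vb wd).
  have := edge_loop_even embedded two_sided sc (edge_path_trans vc wd).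
  by case: b {vb}; case: c {vc}; case: d {wd}.
have /choice[s Hs] := ex (src e0).
exists s => e; apply: (uniq (src e0) (tgt e)); first exact: Hs.
by apply: edge_path_trans (Hs _) _; exact: edge_path1.
Qed.

Variable s : K 0%N -> bool.
Hypothesis sP : potential s.

Lemma potential_cell n (c : K n) w w' :
  (forall i, dual (cell_edge c i) -> w i = w' i) ->
  s (face (cmap_vtx w) c) = s (face (cmap_vtx w') c).
Proof.
move=> H; apply: vertex_upd => u i wi; rewrite -src_edge -tgt_edge sP.
rewrite asboolF ?addbF// => d; move/eqP: wi; apply; apply: H.
by apply: same_hyperplane_trans d _; left; exact: parallel_edge.
Qed.

(** The vertex [w] rounds [x] in the dual directions. Its other coordinates are left free: by
    [potential_cell] they do not affect [s]. *)
Definition side_cond (b : bool) n (c : K n) (x : cube R n) := exists w,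
  s (face (cmap_vtx w) c) = b /\ forall i, dual (cell_edge c i) ->
    if w i then 2^-1 < set_val (x i) else set_val (x i) < 2^-1.

Lemma side_saturated b : saturated (side_cond b).
Proof.
move=> m n a c x; split => -[w [sw H]].
  pose w' i := match a i with inl e => e | inr (j, t) => w j (+) t end.
  exists w'; split.
    rewrite -sw -face_comp; congr (s (face _ _)); apply: cmapP => i.
    by rewrite !ffunE /w'; case: (a i) => [//|[j t]]; rewrite ffunE.
  move=> i d; rewrite /cmap_act /w'; case aE : (a i) => [e|[j t]].
    by rewrite ui_boolE; case: e {aE} => /=; [lra|rewrite invr_gt0].
  have /H : dual (cell_edge (face a c) j) by apply/(same_hyperplane_face _ _ aE).
  by case: t {aE}; rewrite ?ui_oppE ?addbT ?addbF //; case: (w j) => /=; lra.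
have [g Hg] := cmap_pos a.
have /choice[t Ht] : forall j, exists t, a (g j) = inr (j, t).
  move=> j; have := Hg (g j) j; rewrite eqxx.
  by case: (a (g j)) => [//|[l t]] /eqP /= ->; exists t.
exists (fun j => w (g j) (+) t j); split.
  rewrite -sw -face_comp.
  (* Moves [w] into the face. In a dual direction that is constant on the face nothing changes, as
     the point lies at the end to which [w] rounds it. *)
  pose w' i := match a i with inl e => e | inr (j, t') => w i end.
  have -> : cmap_comp a (cmap_vtx (fun j => w (g j) (+) t j)) = cmap_vtx w'.
    apply: cmapP => i; rewrite !ffunE /w'; case aE : (a i) => [//|[j t']].
    have ij : i = g j by apply/eqP; rewrite -Hg aE /=.
    rewrite ffunE ij; have := Ht j; rewrite -ij aE => -[->].
    by rewrite addbK.
  apply: potential_cell => i d; rewrite /w'; case aE : (a i) => [e|[//]].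
  have := H i d; rewrite /cmap_act aE ui_boolE.
  by case: e {aE}; case: (w i) => //=; rewrite ?ltr0n //; lra.
move=> j d; have := H (g j); rewrite /cmap_act Ht => H'.
have /H' : dual (cell_edge c (g j)) by apply/(same_hyperplane_face _ _ (Ht j)).
by case: (t j); rewrite ?ui_oppE ?addbT ?addbF //; case: (w (g j)) => /=; lra.
Qed.

Definition side b : set X := gset (side_cond b).

Lemma sideE b n (c : K n) (x : cube R n) : side b (geo_pt c x) <-> side_cond b c x.
Proof. by apply: gsetE; exact: side_saturated. Qed.

Lemma side_open b : open (side b).
Proof.
apply: gset_open; first exact: side_saturated.
move=> n c; have -> : [set x : cube R n | side_cond b c x] =
    \bigcup_(w in [set w | s (face (cmap_vtx w) c) = b])
      [set x : cube R n | forall i, (fun i r => dual (cell_edge c i) ->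
         if w i then 2^-1 < r else r < 2^-1) i (set_val (x i))].
  by apply/seteqP; split => x /= [w]; [case; exists w|exists w].
apply: bigcup_open => w _; apply: (@open_cube R n (fun i r => dual (cell_edge c i) ->
  if w i then 2^-1 < r else r < 2^-1)) => i.
have [d|nd] := pselect (dual (cell_edge c i)); last first.
  rewrite (_ : (fun r => _) = setT); first exact: openT.
  by apply/seteqP; split => // r _ /nd.
rewrite (_ : (fun r => _) = [set r | if w i then 2^-1 < r else r < 2^-1]); last first.
  by apply/seteqP; split => r /= => [/(_ d)|].
by case: (w i); [exact: open_gt|exact: open_lt].
Qed.

Lemma side_cover z : (~` hyperplane e0) z -> exists b, side b z.
Proof.
elim/geo_ind: z => n c x Hz.
exists (s (face (cmap_vtx (fun i => 2^-1 < set_val (x i))) c)).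
apply/sideE; eexists; split; first reflexivity.
move=> i d /=; case: ltgtP => // xi; exfalso; apply: Hz.
by exists n, c, x, i.
Qed.

Lemma side_disjoint z b b' : side b z -> side b' z -> b = b'.
Proof.
elim/geo_ind: z => n c x; rewrite !sideE => -[w [<- H]] [w' [<- H']].
apply: potential_cell => i d; have := H i d; have := H' i d.
by case: (w i); case: (w' i) => //; lra.
Qed.

Lemma side_hyperplane z b : side b z -> (~` hyperplane e0) z.
Proof.
move=> sz hz; move: hz sz => [n [c [x [i [-> xi d]]]]].
by rewrite sideE => -[w [_ /(_ i d)]]; rewrite xi ltxx; case: ifP.
Qed.

(** The side is open, and closed in the complement of the hyperplane because the other side is open.
    Thus whatever fixes a side pointwise fixes a halfspace pointwise. *)
Lemma component_side b z : side b z ->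
  connected_component (~` hyperplane e0 : set X) z `<=` side b.
Proof.
move=> bz y [C [Cz CH cC] Cy].
suff : C `&` side b = C by move=> E; move: Cy; rewrite -E => -[].
apply: cC; first by exists z.
  by exists (side b) => //; exact: side_open.
exists (~` side (~~ b)); first by apply: open_closedC; exact: side_open.
apply/seteqP; split => x [Cx sx]; split => //.
  by move=> /(side_disjoint sx); case: (b).
have [b' b'x] := side_cover (CH _ Cx).
by case: (eqVneq b b') => [->//|]; case: b b' {bz} sx b'x => -[].
Qed.

Lemma side_vertex v : side (s v) (vpt R v).
Proof.
apply/sideE; exists (fun=> false); split; last by case.
by congr s; rewrite -[RHS]face_id; congr face; apply: cmapP => -[].
Qed.

Section Split.
Variables (g : cube_hom K K).
Hypothesis g_fix : forall n (c : K n) i, dual (cell_edge c i) -> g n c = c.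

Definition split_fun b n (c : K n) := if s (cell_vtx c) == b then g n c else c.

(** A cube without dual edges has all its vertices on one side, so its faces follow the same case of
    the definition; on a cube with a dual edge [g] is the identity and both cases agree. *)
Lemma split_face b m n (a : cmap m n) (c : K n) :
  split_fun b (face a c) = face a (split_fun b c).
Proof.
rewrite /split_fun; have [[i d]|nd] := pselect (exists i, dual (cell_edge c i)).
  by rewrite hom_face (g_fix d) !if_same.
have [w ->] := cell_vtx_face a c.
rewrite (@potential_cell _ _ w (fun=> false)) -/(cell_vtx c).
  by case: ifP => //; rewrite hom_face.
by move=> i d; exfalso; apply: nd; exists i.
Qed.

Definition split_hom b : cube_hom K K := Defs.Hom (split_face b).

Lemma split_fixes_side b z : side (~~ b) z -> geo_map (split_hom b) z = z.
Proof.
elim/geo_ind: z => n c x; rewrite sideE geo_mapE /= /split_fun => -[w [sw H]].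
case: ifP => // /eqP sb; suff [i d] : exists i, dual (cell_edge c i) by rewrite (g_fix d).
apply: contrapT => nd; move: sb; rewrite -(@potential_cell _ _ w) ?sw; first by case: b {sw}.
by move=> i d; exfalso; apply: nd; exists i.
Qed.

End Split.

Section CarrierFix.
Variable g : cube_hom K K.
Hypotheses (g_auto : is_auto g)
  (g_fix : forall n (c : K n) i, dual (cell_edge c i) -> g n c = c).

(** As [g] preserves the hyperplane, [s] composed with [g] is again a potential, hence [s] up to a
    constant, and the two agree at the fixed vertex [src e0]. *)
Lemma carrier_fix_side v : s (g 0%N v) = s v.
Proof.
have ge0 : g 1%N e0 = e0.
  apply: (g_fix (i := ord0)); rewrite cell_edge1; exact: same_hyperplane_refl.
have [h [ha hg gh]] := auto_inv g_auto.
have he0 : h 1%N e0 = e0 by rewrite -{1}ge0 hg.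
have [|b Hb] := @potential_unique _ (fun v => s (g 0%N v)) sP.
  move=> e; rewrite hom_tgt hom_src sP; congr (_ (+) _).
  apply/asboolP/asboolP => d; last by rewrite -ge0; exact: hom_hyperplane.
  by rewrite -he0 -(hg _ e); exact: hom_hyperplane.
rewrite Hb; have := Hb (src e0); rewrite hom_src ge0.
by case: b {Hb}; rewrite ?addbF// addbT; case: (s _).
Qed.

Lemma carrier_fix_Aut_plus : cube_Aut_plus R K (geo_map g).
Proof.
have [h [ha hg gh]] := auto_inv g_auto.
have h_fix n (c : K n) i : dual (cell_edge c i) -> h n c = c.
  by move=> /g_fix E; rewrite -{1}E hg.
have gs := carrier_fix_side.
have hs v : s (h 0%N v) = s v by rewrite -gs gh.
(* Sides are preserved, so splitting the inverse [h] inverts the splitting of [g]. *)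
have split_auto b : is_auto (split_hom g_fix b).
  move=> n; exists (@split_hom h h_fix b n) => c /=; rewrite /split_fun.
    by case E: (s (cell_vtx c) == b); rewrite ?E// -hom_cell_vtx gs E hg.
  by case E: (s (cell_vtx c) == b); rewrite ?E// -hom_cell_vtx hs E gh.
have in_gen b : (cube_Aut R K `&` @fixes_halfspace R K) (geo_map (split_hom g_fix b)).
  split; first by exists (split_hom g_fix b).
  have [v sv] : exists v, s v = ~~ b.
    have := sP e0; rewrite asboolT; last exact: same_hyperplane_refl.
    rewrite addbT; case: (eqVneq (s (src e0)) (~~ b)) => [|ne st]; first by exists (src e0).
    by exists (tgt e0); rewrite st; move: ne; case: (s _); case: b.
  have svp : side (~~ b) (vpt R v) by rewrite -sv; exact: side_vertex.
  exists (connected_component (~` hyperplane e0) (vpt R v)).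
    by exists e0, (vpt R v); split => //; exact: side_hyperplane svp.
  by move=> x /(component_side svp); exact: split_fixes_side.
move=> M [[_ Mcomp _] sub].
(* The image of a cube under the first factor starts on the same side as the cube, so exactly one of
   the two factors applies [g]. *)
have -> : geo_map g = geo_map (split_hom g_fix true) \o geo_map (split_hom g_fix false) :> (X -> X).
  apply: geo_map_comp => n c /=; rewrite /split_fun.
  by case E: (s (cell_vtx c)); rewrite /= ?E // -hom_cell_vtx gs E.
by apply: Mcomp; apply: sub; exact: in_gen.
Qed.

End CarrierFix.

End Potential.

(** * Automorphisms fixing a star *)

Section Squares.
Variable K : cube_complex.
Implicit Types (e f : K 1%N) (q : K 2%N).

Lemma opposite_sym e f : opposite e f -> opposite f e.
Proof.
move=> [q [-> ->]]; exists (face (cmap_refl (fun i => i == ord_max)) q).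
rewrite -!face_comp; split; congr face; apply: cmapP => i;
  by rewrite !ffunE; case: i => -[|[|[]]]//= ?; rewrite ffunE.
Qed.

Lemma endpoints_src e : endpoints e (src e). Proof. exact: or_introl. Qed.
Lemma endpoints_tgt e : endpoints e (tgt e). Proof. exact: or_intror. Qed.

Lemma square_edges q :
  [/\ corner (cell_edge q ord0) (cell_edge q ord_max),
      parallel (cell_edge q ord_max) (face (cmap_edge (fun=> true) ord_max) q),
      src (face (cmap_edge (fun=> true) ord_max) q) = tgt (cell_edge q ord0) &
      src (face (cmap_edge (fun=> true) ord0) q) = tgt (cell_edge q ord_max)].
Proof.
split; [by exists q|exact: cell_edge_true| |];
  rewrite /cell_edge src_edge tgt_edge; congr face; apply: cmap_vtx_ext => -[[|[|[]]]//=];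
  by rewrite /upd.
Qed.

Lemma cmap1_edge n (a : cmap 1 n) (c : K n) : exists w i s,
  face a c = orient s (face (cmap_edge w i) c).
Proof.
have [w [i [s ->]]] := cmap1P a; exists w, i, s; rewrite face_comp.
case: s; rewrite /= /rev_edge ?cmap_rev_refl// cmap_refl_id.
by rewrite face_id.
Qed.

End Squares.

(** * Links in a covering *)

Section Covering.
Variables (R : realType) (S X : cube_complex) (p : cube_hom X S).
Hypothesis S_npc : nonpositively_curved S.
Hypothesis p_covering : covering_map (geo_map p : geo R X -> geo R S).

(** The two cubes have the same image in [S]. Corresponding points close to the common vertex lie in
    one sheet over an evenly covered set, hence coincide, and [geo_normal] compares the cubes. *)
Lemma covering_link_simplicial n (c d : X n) : cell_vtx c = cell_vtx d ->
  (forall i, cell_edge c i = cell_edge d i) -> c = d.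
Proof.
move=> cdv cde.
have pcd : p n c = p n d.
  apply: (link_simplicial S_npc); first by rewrite -!hom_cell_vtx cdv.
  by move=> i; rewrite -!hom_cell_edge cde.
have [_ _ /(_ (geo_map p (vpt R (cell_vtx c))))[V [_ zV] [J [W [oW _ VW Wbij]]]]] := p_covering.
have [i0 _ Wz] : (\bigcup_i W i) (vpt R (cell_vtx c)) by rewrite -VW.
have [[_ Winj _] _] := Wbij i0.
(* For 0 < t < 1 the coordinates are pairwise distinct and lie strictly between 0 and 1/2. An
   isometry of the cube fixing such a point neither permutes nor reflects coordinates. *)
pose x (t : R) : cube R n := fun i => clamp (t / (i.+2)%:R).
have cx : continuous x.
  apply: cube_continuous => i t.
  apply: (@continuous_comp _ _ _ (fun t : R => t / (i.+2)%:R)).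
    by apply: cvgM; [exact: cvg_id|exact: cvg_cst].
  exact: clamp_continuous.
have near_W (b : X n) : cell_vtx b = cell_vtx c -> \forall t \near (0 : R), W i0 (geo_pt b (x t)).
  move=> bc; have cb : continuous (fun t => geo_pt b (x t)).
    by move=> t; apply: (@continuous_comp _ _ _ x); [exact: cx|exact: geo_pt_continuous].
  apply: (cb 0 (W i0)); apply: open_nbhs_nbhs; split; first exact: oW.
  suff -> : geo_pt b (x 0) = vpt R (cell_vtx c) by [].
  rewrite -bc /vpt /cell_vtx geo_glue; congr geo_pt; apply: cube_ext => i.
  by rewrite /x /cmap_act ffunE mul0r clamp0.
have /nbhs_ballP[e /= e0 He] :
    nbhs (0 : R) [set t | W i0 (geo_pt c (x t)) /\ W i0 (geo_pt d (x t))].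
  by apply: filterI; apply: near_W.
pose t : R := Num.min e 1 / 2.
have m0 : 0 < Num.min e 1 by rewrite lt_min e0 ltr01.
have m1 : Num.min e 1 <= 1 by rewrite ge_min lexx orbT.
have me : Num.min e 1 <= e by rewrite ge_min lexx.
have t0 : 0 < t by rewrite /t; lra.
have t1 : t < 1 by rewrite /t; lra.
have [Wc Wd] : W i0 (geo_pt c (x t)) /\ W i0 (geo_pt d (x t)).
  by apply: He; rewrite /ball /= sub0r normrN gtr0_norm// /t; lra.
have xE i : set_val (x t i) = t / (i.+2)%:R.
  rewrite clampE// divr_ge0 ?(ltW t0)//= ler_pdivrMr ?ltr0n// mul1r.
  by apply: (le_trans (ltW t1)); rewrite ler1n.
have x_gt0 i : 0 < set_val (x t i) by rewrite xE divr_gt0.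
have x_lt i : set_val (x t i) < 2^-1.
  rewrite xE ltr_pdivrMr ?ltr0n// mulrC -ltr_pdivrMr ?invr_gt0// invrK.
  have : 2%:R <= (i.+2)%:R :> R by rewrite ler_nat.
  by move=> i2; apply: lt_le_trans i2; lra.
have cdx : geo_pt c (x t) = geo_pt d (x t).
  by apply: Winj; rewrite ?inE// !geo_mapE pcd.
have [i|a [<- ax]] := geo_normal _ cdx.
  by rewrite x_gt0/=; apply: lt_trans (x_lt i) _; lra.
suff -> : a = cmap_id n by rewrite face_id.
apply: cmapP => i; have := congr1 (fun y : cube R n => set_val (y i)) ax.
rewrite /cmap_act ffunE; case: (a i) => [b|[j s]].
  move=> E; have x1 := x_lt i; have x0 := x_gt0 i; exfalso; move: x1 x0; rewrite -E ui_boolE.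
  by case: b {E} => /=; rewrite ?ltxx// (_ : 1%:R = 1)//; lra.
case: s => [E|].
  by exfalso; have := x_lt i; have := x_lt j; rewrite -E ui_oppE; lra.
rewrite !xE => /(mulfI (lt0r_neq0 t0))/invr_inj/eqP; rewrite eqr_nat eqSS eqSS => /eqP ji.
by congr (inr (_, _)); apply: val_inj.
Qed.

End Covering.

(** * Corners, squares and labels *)

Section Labels.
Variables (R : realType) (X : cube_complex).
Variables (Sigma0 : finType) (inv : Sigma0 -> Sigma0) (l : X 1%N -> Sigma0).
Hypothesis sc : simply_connected R (geo R X).
Hypothesis embedded : forall e0 e f : X 1%N,
  same_hyperplane e0 e -> same_hyperplane e0 f -> ~ corner e f.
Hypothesis two_sided : forall e : X 1%N, ~ parallel e (rev_edge e).
Hypothesis simplicial : forall n (c d : X n), cell_vtx c = cell_vtx d ->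
  (forall i, cell_edge c i = cell_edge d i) -> c = d.
Hypothesis l_adm : admissible inv l.
Hypothesis all_labels : forall v s, exists e, src e = v /\ l e = s.
Implicit Types e f : X 1%N.

Lemma no_loop e : src e <> tgt e.
Proof.
have [s sP] := potential_exists sc (@embedded e) (@two_sided e).
move=> E; have := sP e; rewrite -E asboolT; last exact: same_hyperplane_refl.
by case: (s _).
Qed.

(** Condition (A3) speaks of edges with exactly one common endpoint. The targets differ: [e] crosses
    its own hyperplane, while [f] does not, by embeddedness. *)
Lemma corner_span e f : corner e f -> span_square e f.
Proof.
move=> ef; have sef := corner_src ef.
have [s sP] := potential_exists sc (@embedded e) (@two_sided e).
split; last first.
  move: ef => [q [<- <-]]; exists q.
  by exists (cmap_edge (fun=> false) ord0), (cmap_edge (fun=> false) ord_max).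
exists (src e); apply/seteqP; split => [x|_ ->] /=; last first.
  by split; [|rewrite sef]; exact: endpoints_src.
move=> [[->|->] [E|E]] //; first by rewrite E sef.
exfalso; have := sP f; have := sP e; rewrite E sef => ->.
rewrite asboolT; last exact: same_hyperplane_refl.
rewrite asboolF; first by case: (s _).
by move=> d; apply: (embedded (same_hyperplane_refl e) d ef).
Qed.

(** The sources of opposite sides of a square are joined by an edge cornering with a dual edge,
    which by embeddedness does not cross the hyperplane. *)
Lemma potential_parallel e0 s e f : potential e0 s -> parallel e f ->
  same_hyperplane e0 e -> s (src e) = s (src f).
Proof.
move=> sP; elim=> [x y [q [-> ->]]|x|x y xy IH|x y z xy IH yz IH'] // d.
- have [cq _ _ ->] := square_edges q; rewrite sP src_cell_edge.
  rewrite src_cell_edge asboolF ?addbF// => d'; exact: (embedded d d' cq).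
- symmetry; apply: IH; apply: same_hyperplane_trans d _; left; exact: parallel_sym.
- by rewrite IH// IH'//; apply: same_hyperplane_trans d _; left.
Qed.

Lemma span_corner e f : src e = src f -> span_square e f -> corner e f.
Proof.
move=> sef [[v efv] [q [a [b [aq bq]]]]].
have [w [i [s eE]]] := cmap1_edge a q; rewrite aq in eE.
have [w' [j [t fE]]] := cmap1_edge b q; rewrite bq in fE.
have vE x : endpoints e x -> endpoints f x -> x = src e.
  move=> ex fx; have : (endpoints e `&` endpoints f) (src e).
    by split; [|rewrite sef]; exact: endpoints_src.
  have : (endpoints e `&` endpoints f) x by [].
  by rewrite efv => -> ->.
have ends e' u k r : e' = orient r (face (cmap_edge u k) q) -> forall m,
    endpoints e' (face (cmap_vtx (upd u k m)) q).
  move=> -> m; have [e1 e2] := (endpoints_src (orient r (face (cmap_edge u k) q)),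
    endpoints_tgt (orient r (face (cmap_edge u k) q))).
  by move: e1 e2; case: r; case: m; rewrite /= ?src_rev ?tgt_rev src_edge tgt_edge.
case: (eqVneq i j) => [ij|ij]; last first.
  (* The vertex of the square where its sides in the directions [i] and [j] meet. It must be the
     common source, and reflecting the square in [u] exhibits the corner there. *)
  pose u k := if k == i then w' i else w j.
  have ji : j != i by rewrite eq_sym.
  have uE k : (k == i) || (k == j).
    by case: i j k ij {eE fE ji u} => -[|[|[]]]//= ? [[|[|[]]]//= ?] [[|[|[]]]//= ?].
  have u1 : cmap_vtx u = cmap_vtx (upd w i (w' i)).
    apply: cmap_vtx_ext => k; rewrite /u /upd; case: eqVneq => // ki.
    by have := uE k; rewrite (negbTE ki) => /eqP ->.
  have u2 : cmap_vtx u = cmap_vtx (upd w' j (w j)).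
    apply: cmap_vtx_ext => k; rewrite /u /upd; have := uE k.
    by case: eqVneq => [->|ki /= ->//]; rewrite (negbTE ij).
  have us : face (cmap_vtx u) q = src e.
    by apply: vE; [rewrite u1; exact: ends eE _|rewrite u2; exact: ends fE _].
  have orient_src e' x k r m : e' = orient r (face (cmap_edge x k) q) ->
      face (cmap_vtx (upd x k m)) q = src e' -> m = r.
    move=> -> ; have := @no_loop (face (cmap_edge x k) q).
    rewrite tgt_edge src_edge.
    by case: r => /=; rewrite ?src_rev ?tgt_edge ?src_edge; case: m => // + E; rewrite E.
  have sE : w' i = s by apply: (orient_src _ _ _ _ _ eE); rewrite -u1.
  have tE : w j = t by apply: (orient_src _ _ _ _ _ fE); rewrite -u2 us.
  have ueE : cmap_edge u i = cmap_edge w i.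
    apply: cmap_edge_ext => k ki; rewrite /u (negbTE ki).
    by have := uE k; rewrite (negbTE ki) => /eqP ->.
  have ufE : cmap_edge u j = cmap_edge w' j.
    apply: cmap_edge_ext => k kj; rewrite /u.
    by have := uE k; rewrite (negbTE kj) orbF => /eqP ->; rewrite eqxx.
  have := corner_cell (face (cmap_refl u) q) ij.
  rewrite !cell_edge_refl ueE ufE {1}/u eqxx sE {1}/u (negbTE ji) tE.
  by rewrite eE fE.
exfalso; subst j.
have ef : parallel (orient (s (+) t) e) f.
  rewrite eE fE orient_orient addbAC addbb addFb.
  by apply: parallel_orient; exact: parallel_edge.
(* Sides in the same direction are parallel up to orientation. If antiparallel, their common source
   would lie on both sides of the hyperplane; if parallel, they are equal by (A2) and share both
   endpoints. *)
case st : (s (+) t) ef => /= ef.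
  have [k kP] := potential_exists sc (@embedded e) (@two_sided e).
  have := potential_parallel kP ef (same_hyperplane_rev e).
  rewrite src_rev kP -sef asboolT; last exact: same_hyperplane_refl.
  by case: (k _).
have efE : e = f by apply: (label_inj l_adm sef); exact: (label_parallel l_adm ef).
by apply: (@no_loop e); rewrite (vE (tgt e))// -?efE; exact: endpoints_tgt.
Qed.

Lemma corner_label e1 e2 f1 f2 : corner e1 e2 -> src f1 = src f2 ->
  l e1 = l f1 -> l e2 = l f2 -> corner f1 f2.
Proof.
move=> c12 sf l1 l2; apply: span_corner => //.
by apply/(label_square l_adm (corner_src c12) sf l1 l2); exact: corner_span.
Qed.

Lemma corner_commute e f : corner e f -> labels_commute l (l e) (l f).
Proof.
by move=> ef; exists e, f; split => //; [exact: corner_src|exact: corner_span].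
Qed.

Lemma commute_corner e f : src e = src f -> labels_commute l (l e) (l f) -> corner e f.
Proof.
move=> ef [e' [f' [s' le lf H]]]; apply: span_corner => //.
exact/(label_square l_adm s' ef le lf).
Qed.

Section Fix.
Variables (g : cube_hom X X) (s : Sigma0).
Hypothesis g_auto : is_auto g.
Hypothesis flat : forall t r, t <> r ->
  labels_commute l s t -> labels_commute l s r -> t = inv r \/ labels_commute l t r.
Hypothesis inv_involutive : involutive inv.

Definition fixes_link e := g 1%N e = e /\ forall f, corner e f -> g 1%N f = f.

Lemma fix_cell n (c : X n) : g 0%N (cell_vtx c) = cell_vtx c ->
  (forall i, g 1%N (cell_edge c i) = cell_edge c i) -> g n c = c.
Proof.
by move=> v e; apply: simplicial => [|i]; rewrite -?hom_cell_vtx -?hom_cell_edge.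
Qed.

Lemma fix_square q : g 1%N (cell_edge q ord0) = cell_edge q ord0 ->
  g 1%N (cell_edge q ord_max) = cell_edge q ord_max -> g 2%N q = q.
Proof.
move=> e0 e1; apply: fix_cell.
  by rewrite -(src_cell_edge q ord0) hom_src e0.
move=> -[[|[|[]]]//= k].
  by rewrite (_ : Ordinal k = ord0)//; apply: val_inj.
by rewrite (_ : Ordinal k = ord_max)//; apply: val_inj.
Qed.

(* Crossing the square with sides x and a, of label t: every label at the far
   end commuting with s is t^-1, or t, or commutes with t. All but the edge
   labelled t are thus fixed, and then so is that one by injectivity of g. *)
Lemma fixes_link_opposite x y : opposite x y -> l x = s ->
  fixes_link x -> fixes_link y.
Proof.
move=> [q [xq yq]] lx [gx gxf]; pose a := cell_edge q ord_max.
have [xa _ _ sy] := square_edges q.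
rewrite -/a -yq -[cell_edge q ord0]xq in xa sy.
have ga : g 1%N a = a by exact: gxf.
have gq : g 2%N q = q by apply: fix_square => //; rewrite /cell_edge -xq.
have gy : g 1%N y = y by rewrite yq hom_face gq.
have gra : g 1%N (rev_edge a) = rev_edge a by rewrite hom_rev ga.
have ly : l y = s.
  rewrite -lx; apply: (label_parallel l_adm); apply: parallel_sym.
  by rewrite xq yq; exact: parallel_edge.
have others b : corner y b -> l b <> l a -> g 1%N b = b.
  move=> yb lba; have sb := corner_src yb.
  have [E|ab] := @flat (l a) (l b) (nesym lba)
      (ltac:(rewrite -lx; exact: corner_commute)) (ltac:(rewrite -ly; exact: corner_commute)).
    suff -> : b = rev_edge a by [].
    apply: (label_inj l_adm); first by rewrite -sb src_rev.
    by rewrite (label_rev l_adm) E inv_involutive.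
  (* The edge [b] carried back along [a], found by its label. It corners with [x] by (A3), so [g]
     fixes it; [b] is then the side opposite to it in the square spanned by [a] and [b0]. *)
  have [b0 [sb0 lb0]] := all_labels (src x) (l b).
  have xb0 : corner x b0 by apply: (corner_label yb) => //; rewrite ly lx.
  have ab0 : corner a b0.
    by apply: commute_corner; rewrite ?lb0// sb0; exact/esym/(corner_src xa).
  have [q' [q'a q'b]] := ab0.
  have gq' : g 2%N q' = q' by apply: fix_square; rewrite ?q'a ?q'b//; exact: gxf.
  have [_ bp sbt _] := square_edges q'; rewrite q'a in sbt; rewrite q'b in bp.
  have -> : b = face (cmap_edge (fun=> true) ord_max) q'.
    apply: (label_inj l_adm); first by rewrite -sb sbt.
    by rewrite -(label_parallel l_adm bp).
  by rewrite hom_face gq'.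
split => // b yb; have [lba|lba] := eqVneq (l b) (l a); last by apply: others => //; exact/eqP.
have ygb : corner y (g 1%N b) by rewrite -gy; exact: hom_corner.
have [lgb|lgb] := eqVneq (l (g 1%N b)) (l a).
  by apply: (label_inj l_adm); [rewrite -(corner_src yb) -(corner_src ygb)|rewrite lgb lba].
by apply: (bij_inj (g_auto 1%N)); apply: others => //; exact/eqP.
Qed.

Lemma fixes_link_parallel x y : parallel x y -> l x = s -> fixes_link x -> fixes_link y.
Proof.
move=> xy lx; suff [] : fixes_link x <-> fixes_link y by [].
elim: xy lx => {x y} [x y xy|x|x y xy IH|x y z xy IH yz IH'] lx //.
- have ly : l y = s by rewrite -lx; symmetry; apply: (label_parallel l_adm); exact: rst_step.
  by split; apply: fixes_link_opposite => //; exact: opposite_sym.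
- by symmetry; apply: IH; rewrite -lx; exact: (label_parallel l_adm xy).
- by rewrite IH// IH'// -lx; symmetry; exact: (label_parallel l_adm xy).
Qed.

Lemma fixes_carrier e0 : l e0 = s -> fixes_link e0 ->
  forall n (c : X n) i, same_hyperplane e0 (cell_edge c i) -> g n c = c.
Proof.
move=> le0 fe0.
have H n (c : X n) i : parallel e0 (cell_edge c i) -> g n c = c.
  move=> pc; have [gc gl] := fixes_link_parallel pc le0 fe0.
  apply: fix_cell => [|j]; first by rewrite -(src_cell_edge c i) hom_src gc.
  by case: (eqVneq i j) => [<-//|ij]; apply: gl; exact: corner_cell.
(* A cube crossed in the direction opposite to [e0] is reduced to the other case by reflecting its
   coordinate [i]. *)
move=> n c i [/H//|pc]; pose w (k : 'I_n) := k == i.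
rewrite -(face_refl2 c w) hom_face (H _ _ i)// cell_edge_refl /w eqxx.
by apply: parallel_trans pc _; apply: parallel_rev; exact: parallel_edge.
Qed.

Lemma fixes_star_Aut_plus v : (forall e, src e = v -> g 1%N e = e) ->
  cube_Aut_plus R X (geo_map g).
Proof.
move=> gv; have [e0 [se0 le0]] := all_labels v s.
have [k kP] := potential_exists sc (@embedded e0) (@two_sided e0).
apply: (@carrier_fix_Aut_plus R X sc e0 k kP g g_auto).
apply: (fixes_carrier le0); split; first exact: gv.
by move=> f /corner_src sf; apply: gv; rewrite -sf.
Qed.

End Fix.
End Labels.

(** * Local compactness *)

Section AutGroup.
Variables (R : realType) (X : cube_complex).

Lemma cube_Aut_subgroup : subgroup (cube_Aut R X).
Proof.
split.
- exists (@hom_id X); first by move=> n; exists id.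
  exact: geo_map_id.
- move=> _ _ [g ga <-] [h ha <-]; exists (hom_comp g h).
    by move=> n; apply: bij_comp; [exact: ga|exact: ha].
  exact: geo_map_comp.
move=> _ k [g ga <-] gk kg; have [h [ha hg gh]] := auto_inv ga.
exists h => //; apply/funext => z.
rewrite -[in LHS](kg z) -[LHS]/((geo_map h \o geo_map g) (k z)).
by rewrite -(@geo_map_comp _ _ _ _ h g (hom_comp h g)) ?geo_map_id.
Qed.

Lemma cube_Aut_plus_sub : cube_Aut_plus R X `<=` cube_Aut R X.
Proof.
by apply: smallest_sub; [exact: cube_Aut_subgroup|move=> f []].
Qed.

Lemma cube_Aut_plus_comp f g : cube_Aut_plus R X f -> cube_Aut_plus R X g ->
  cube_Aut_plus R X (f \o g).
Proof.
move=> Hf Hg M /[dup] HM [[_ Mc _] _].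
by apply: Mc; [exact: Hf|exact: Hg].
Qed.

Lemma edge_star_geo_map (g : cube_hom X X) e e' :
  edge_star e' (geo_map g (geo_pt e (third_pt R))) <-> g 1%N e = e'.
Proof. by rewrite geo_mapE edge_starE. Qed.

Lemma geo_map_inj_edge (g h : cube_hom X X) :
  geo_map g = geo_map h :> (geo R X -> geo R X) -> forall e, g 1%N e = h 1%N e.
Proof. by move=> gh e; apply/edge_star_geo_map; rewrite gh; apply/edge_star_geo_map. Qed.

End AutGroup.

(** * Limits of automorphisms along an ultrafilter *)

Section UltraLimit.
Variables (X : cube_complex) (Sigma0 : finType) (l : X 1%N -> Sigma0).
Hypothesis l_inj : forall e f, src e = src f -> l e = l f -> e = f.
Hypothesis simplicial : forall n (c d : X n), cell_vtx c = cell_vtx d ->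
  (forall i, cell_edge c i = cell_edge d i) -> c = d.
Hypothesis X_connected : forall v w : X 0%N, path_connected v w.
Variables (T : Type) (F : set_system T) (k : T -> cube_hom X X).
Hypothesis F_ultra : UltraFilter F.

Let F_filter : Filter F := @filter_filter _ _ (@ultra_proper _ _ F_ultra).

(** Otherwise [F] would contain the complement of every fibre, and so their finite intersection,
    which is empty. *)
Lemma ultra_pigeonhole (a : T -> Sigma0) : exists s, F [set t | a t = s].
Proof.
apply: contrapT => /forallNP H.
have /filter_ex[t Ht] : F [set t | forall s, a t <> s].
  suff K s : \forall t \near F, a t <> s by exact: filter_forall K.
  by have [/H|] := in_ultra_setVsetC [set t | a t = s] F_ultra.
exact: (Ht (a t)).
Qed.

Let converges n (c : X n) := exists d, F [set t | k t n c = d].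

(** Local finiteness enters here: automorphisms may change labels, but the label of the image of [e]
    is constant on a set of [F], and with the image of the source it determines the image of [e]. *)
Lemma converges_edge e : converges (src e) -> converges e.
Proof.
move=> [w Fw]; have [s Fs] := ultra_pigeonhole (fun t => l (k t 1%N e)).
have FI := @filterI _ _ F_filter _ _ Fw Fs; have [t0 [t0w t0s]] := filter_ex FI.
exists (k t0 1%N e); apply: filterS FI => t [/= tw ts].
by apply: l_inj; rewrite ?ts ?t0s// -!hom_src tw t0w.
Qed.

Lemma converges_tgt e : converges e -> converges (tgt e).
Proof.
move=> [d Fd]; exists (tgt d); apply: filterS Fd => t /= <-.
by rewrite hom_tgt.
Qed.

Lemma ultra_limit (v : X 0%N) : converges v ->
  exists g : cube_hom X X, forall n (c : X n), F [set t | k t n c = g n c].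
Proof.
(* Convergence passes from the source of an edge to the edge and on to its target, and thus along
   edge paths to every vertex. *)
move=> cv; have cvtx (w : X 0%N) : converges w.
  have [b H] := X_connected v w; elim: H cv => // e u b' _ IH ce.
  by apply/IH/converges_tgt/converges_edge.
have ccell n (c : X n) : converges c.
  have [v' Fv] := cvtx (cell_vtx c).
  have /choice[e' Fe] : forall i, converges (cell_edge c i).
    by move=> i; apply: converges_edge; exact: cvtx.
  have FI := @filterI _ _ F_filter _ _ Fv (filter_forall F_filter Fe).
  have [t0 [t0v t0e]] := filter_ex FI.
  exists (k t0 n c); apply: filterS FI => t [/= tv te].
  apply: simplicial => [|i]; first by rewrite -!hom_cell_vtx tv t0v.
  by rewrite -!hom_cell_edge te t0e.
pose g n (c : X n) := sval (cid (ccell n c)).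
have Hg n (c : X n) : F [set t | k t n c = g n c] by rewrite /g; case: cid.
have gf m n (a : cmap m n) (c : X n) : g m (face a c) = face a (g n c).
  have [t [<- <-]] := filter_ex (@filterI _ _ F_filter _ _ (Hg _ (face a c)) (Hg _ c)).
  by rewrite hom_face.
by exists (Defs.Hom gf).
Qed.

End UltraLimit.

Section LocallyCompact.
Variables (R : realType) (X : cube_complex).
Variables (Sigma0 : finType) (inv : Sigma0 -> Sigma0) (l : X 1%N -> Sigma0).
Hypothesis sc : simply_connected R (geo R X).
Hypothesis embedded : forall e0 e f : X 1%N,
  same_hyperplane e0 e -> same_hyperplane e0 f -> ~ corner e f.
Hypothesis two_sided : forall e : X 1%N, ~ parallel e (rev_edge e).
Hypothesis simplicial : forall n (c d : X n), cell_vtx c = cell_vtx d ->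
  (forall i, cell_edge c i = cell_edge d i) -> c = d.
Hypothesis l_adm : admissible inv l.
Hypothesis all_labels : forall v s, exists e, src e = v /\ l e = s.
Hypothesis inv_involutive : involutive inv.
Variable s0 : Sigma0.
Hypothesis flat : forall t r, t <> r ->
  labels_commute l s0 t -> labels_commute l s0 r -> t = inv r \/ labels_commute l t r.

Lemma star_agree (g h : cube_hom X X) v : g 0%N v = h 0%N v ->
  (forall e, src e = v -> g 1%N e = h 1%N e) ->
  forall z, vertex_star v z -> geo_map g z = geo_map h z :> geo R X.
Proof.
move=> ghv ghe; elim/geo_ind => n c x /vertex_starP[w cw].
rewrite !geo_mapE -(face_refl2 c w) (hom_face g) (hom_face h); congr (geo_pt (face _ _)).
have cv : cell_vtx (face (cmap_refl w) c) = v by rewrite cell_vtx_refl.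
apply: simplicial => [|i]; first by rewrite -!hom_cell_vtx cv.
by rewrite -!hom_cell_edge ghe// src_cell_edge.
Qed.

Lemma geo_map_inj (g h : cube_hom X X) :
  geo_map g = geo_map h :> (geo R X -> geo R X) -> forall n (c : X n), g n c = h n c.
Proof.
move=> /geo_map_inj_edge ghe n c.
have ghv v : g 0%N v = h 0%N v.
  by have [e [<- _]] := all_labels v s0; rewrite !hom_src ghe.
by apply: simplicial => [|i]; rewrite -?hom_cell_vtx -?hom_cell_edge.
Qed.

Let G : Type := set_type (cube_Aut_plus R X).

Lemma Aut_plus_hom (f : G) : exists g : cube_hom X X * cube_hom X X,
  [/\ is_auto g.1, set_val f = geo_map g.1 :> (geo R X -> geo R X),
      forall n (c : X n), g.2 n (g.1 n c) = c &
      forall n (c : X n), g.1 n (g.2 n c) = c].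
Proof.
have /cube_Aut_plus_sub[g ga gf] := set_valP f.
by have [h [ha hg gh]] := auto_inv ga; exists (g, h).
Qed.

Let homs (f : G) := sval (cid (Aut_plus_hom f)).
Let hom f := (homs f).1.
Let hom' f := (homs f).2.

Let hom_auto f : is_auto (hom f).
Proof. by rewrite /hom /homs; case: cid => ? []. Qed.
Let homE f : set_val f = geo_map (hom f) :> (geo R X -> geo R X).
Proof. by rewrite /hom /homs; case: cid => ? []. Qed.
Let homK f n (c : X n) : hom' f n (hom f n c) = c.
Proof. by rewrite /hom /hom' /homs; case: cid => ? []. Qed.
Let hom'K f n (c : X n) : hom f n (hom' f n c) = c.
Proof. by rewrite /hom /hom' /homs; case: cid => ? []. Qed.

(** Sending the single point one third along [e] into a given open half-star is a subbasic open
    condition, and it determines the image of [e] as an oriented edge. *)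
Lemma near_same_edge (f : set_type (cube_Aut_plus R X)) e :
  \forall f' \near f, hom f' 1%N e = hom f 1%N e.
Proof.
pose z := geo_pt e (third_pt R).
pose D : set {compact-open, geo R X -> geo R X} :=
  [set k | k @` [set z] `<=` edge_star (hom f 1%N e)].
have oD : open D.
  by apply: compact_open_open; [exact: compact_set1|exact: edge_star_open].
have Df : D (set_val f).
  by move=> _ [_ -> <-]; rewrite homE; apply/(@edge_star_geo_map R).
have : nbhs f (set_val @^-1` D).
  by apply: initial_continuous; apply: open_nbhs_nbhs.
apply: filterS => f' /= Df'; apply/(@edge_star_geo_map R); rewrite -homE.
by apply: Df'; exists z.
Qed.

(** On each open vertex star the maps are eventually equal to [f], as only the finitely many edges
    at the vertex matter. These stars cover the realization, so on a compact set equality holds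
    eventually throughout. *)
Lemma Aut_plus_cvg (F : set_system G) (f : set_type (cube_Aut_plus R X)) :
  Filter F -> (forall n (c : X n), F [set f' | hom f' n c = hom f n c]) -> F --> f.
Proof.
move=> FF Ff.
have cvg : set_val @ F --> (set_val f : {compact-open, geo R X -> geo R X}).
  apply/compact_open_cvgP => K U Kc oU fKU.
  have H v : F [set f' : G | forall z, vertex_star v z -> set_val f' z = set_val f z].
    have /choice[E HE] := all_labels v.
    have FE : F [set f' | forall s, hom f' 1%N (E s) = hom f 1%N (E s)].
      apply: (@filter_forall _ _ (fun s f' => hom f' 1%N (E s) = hom f 1%N (E s))) => s.
      exact: Ff.
    apply: filterS (filterI (Ff _ v) FE) => f' [/= fv fE] z vz.
    rewrite !homE; apply: star_agree vz => // e ev.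
    have [Es El] := HE (l e).
    by rewrite -(label_inj l_adm _ El) ?fE// Es ev.
  have KF : \forall f' \near F, K `<=` [set z | set_val f' z = set_val f z].
    have /compact_near_coveringP nc := Kc.
    apply: (nc G F (fun f' z => set_val f' z = set_val f z)) => z _.
    have [v vz] := vertex_star_cover z.
    exists (vertex_star v, [set f' : G | forall z, vertex_star v z ->
      set_val f' z = set_val f z]) => [|[y f'] [] /= vy]; last exact.
    by split; [apply: open_nbhs_nbhs; split => //; exact: vertex_star_open|exact: H].
  by apply: filterS KF => f' Hf' _ [z Kz <-]; apply: fKU; exists z => //; rewrite Hf'.
move=> U [? /= [[D oD <-]] /= Df sub].
have H : F (set_val @^-1` D) by apply: cvg; exact: open_nbhs_nbhs.
by apply: filterS H => f' Df'; exact: sub.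
Qed.

Variable v0 : X 0%N.

Lemma Aut_plus_locally_compact : locally_compact [set: set_type (cube_Aut_plus R X)].
Proof.
move=> f0 _; have /choice[E HE] := all_labels v0.
have Ev e : src e = v0 -> e = E (l e).
  by move=> ev; have [Es El] := HE (l e); apply: (label_inj l_adm); rewrite ?Es.
pose same f f' := forall s, hom f' 1%N (E s) = hom f 1%N (E s).
have near_same f : \forall f' \near (f : set_type (cube_Aut_plus R X)), same f f'.
  exact: (@filter_forall _ _ (fun s f' => hom f' 1%N (E s) = hom f 1%N (E s)) _ _
    (fun s => near_same_edge f (E s))).
exists (same f0 : set (set_type (cube_Aut_plus R X))).
  by apply: filterS (near_same f0) => f.
split; last first.
  (* The classes of the equivalence relation [same] are open, so each of them is closed as well. *)
  rewrite -[X in closed X]setCK; apply: open_closedC; rewrite openE => f nf.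
  apply: filterS (near_same f) => f' ff' f0f'; apply: nf => s.
  by rewrite -f0f' ff'.
rewrite compact_ultra => F FU FS.
have FF : Filter F := @filter_filter _ _ (@ultra_proper _ _ FU).
have FP : ProperFilter F := @ultra_proper _ _ FU.
have Xc := vertices_connected sc.
have hom_v0 f : same f0 f -> hom f 0%N v0 = hom f0 0%N v0.
  by move=> /(_ s0); have [<- _] := HE s0; rewrite !hom_src => ->.
have [g Hg] : exists g : cube_hom X X, forall n (c : X n), F [set f | hom f n c = g n c].
  apply: (ultra_limit (label_inj l_adm) simplicial Xc FU (v := v0)).
  by exists (hom f0 0%N v0); apply: filterS FS => f /hom_v0.
(* The inverses are controlled at the image of [v0], which they all send back to [v0]. Their limit
   makes [g] bijective. *)
have [h Hh] : exists h : cube_hom X X, forall n (c : X n), F [set f | hom' f n c = h n c].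
  apply: (ultra_limit (label_inj l_adm) simplicial Xc FU (v := hom f0 0%N v0)).
  by exists v0; apply: filterS FS => f /hom_v0 <-; rewrite /= homK.
have gh n (c : X n) : g n (h n c) = c.
  have [f [<- <-]] := filter_ex (filterI (Hg _ (h n c)) (Hh _ c)).
  by rewrite hom'K.
have hg n (c : X n) : h n (g n c) = c.
  have [f [<- <-]] := filter_ex (filterI (Hh _ (g n c)) (Hg _ c)).
  by rewrite homK.
have g_auto : is_auto g by move=> n; exists (@hom_fun _ _ h n).
have gE e : src e = v0 -> g 1%N e = hom f0 1%N e.
  move=> /Ev ->; have [f [<- fS]] := filter_ex (filterI (Hg _ (E (l e))) FS).
  exact: fS.
have [h0 [h0a h0f f0h]] := auto_inv (hom_auto f0).
(* Membership of the limit: [g] and [f0] agree on the edges at [v0], so the inverse of [f0] composed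
   with [g] fixes that star. *)
have Aut_u : cube_Aut_plus R X (geo_map (hom_comp h0 g)).
  apply: (fixes_star_Aut_plus sc embedded two_sided simplicial l_adm all_labels
    (s := s0) _ flat inv_involutive (v := v0)).
    by move=> n; apply: bij_comp; [exact: h0a|exact: g_auto].
  by move=> e ev /=; rewrite gE// h0f.
have Aut_g : cube_Aut_plus R X (geo_map g).
  rewrite (@geo_map_comp R _ _ _ (hom f0) (hom_comp h0 g) g).
    by apply: cube_Aut_plus_comp => //; rewrite -homE; exact: set_valP.
  by move=> n c /=; rewrite f0h.
pose f : G := exist _ (geo_map g : {compact-open, geo R X -> geo R X}) (mem_set Aut_g).
exists f; split.
  move=> s; rewrite -gE; last by have [] := HE s.
  by apply: (@geo_map_inj_edge R); rewrite -homE.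
apply: Aut_plus_cvg => n c.
suff -> : hom f n c = g n c by exact: Hg.
by apply: geo_map_inj; rewrite -homE.
Qed.

End LocallyCompact.

Theorem theorem7 (R : realType) (S X : cube_complex) (p : cube_hom X S)
    (Sigma0 : finType) (inv : Sigma0 -> Sigma0) (l : X 1%N -> Sigma0)
    (S_compact : compact [set: geo R S])
    (S_connected : connected [set: geo R S])
    (S_npc : nonpositively_curved S)
    (S_special : special S)
    (p_universal : universal_covering R p)
    (inv_involutive : involutive inv)
    (inv_fixfree : forall s, inv s <> s)
    (l_admissible : admissible inv l)
    (l_surjective : forall s, exists e, l e = s)
    (l_invariant : forall g, deck p g -> forall e, l (g 1%N e) = l e)
    (vertex_transitive : forall v w : X 0%N, exists2 g, deck p g & g 0%N v = w)
    (flat_label : exists s, forall t r, t <> r ->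
       labels_commute l s t -> labels_commute l s r ->
       t = inv r \/ labels_commute l t r) :
  locally_compact [set: set_type (cube_Aut_plus R X)].
Proof.
have [p_covering sc] := p_universal.
have [s flat] := flat_label; have [e _] := l_surjective s.
(* Every label occurs somewhere, and a deck transformation moves such an edge to [v] without
   changing its label. *)
have all_labels v t : exists f, src f = v /\ l f = t.
  have [f lf] := l_surjective t; have [g dg gv] := vertex_transitive (src f) v.
  by exists (g 1%N f); rewrite -hom_src gv l_invariant.
(* The covering maps hyperplanes into hyperplanes and corners to corners, so a self-crossing
   upstairs would give one in [S]. *)
have embedded (e0 f f' : X 1%N) : same_hyperplane e0 f -> same_hyperplane e0 f' -> ~ corner f f'.
  move=> ef ef' ff'; apply: (hyp_embedded S_special (e := p 1%N e0)).
  exists (p 1%N f), (p 1%N f').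
  by split; [exact: hom_hyperplane ef|exact: hom_hyperplane ef'|exact: hom_corner ff'].
have two_sided (f : X 1%N) : ~ parallel f (rev_edge f).
  by move=> ff; have := hom_parallel p ff; rewrite hom_rev; exact: (hyp_two_sided S_special).
exact: (Aut_plus_locally_compact sc embedded two_sided
  (covering_link_simplicial S_npc p_covering) l_admissible all_labels
  inv_involutive flat (src e)).
Qed.
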